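(* Let $M$ be a closed, oriented, irreducible, atoroidal 3-manifold and let $\varphi$ be an Anosov flow on $M$ with orientable weak stable and unstable foliations $W^s,W^u$, adapted to $W^u$. Let $\mathcal{O}=\widetilde M/\widetilde\varphi$ be its flow space, $\mathcal{L}$ the leaf space of $\widetilde W^u$, $E_\infty$ the circle bundle at infinity over $\mathcal{L}$, and $s_{\mathbf{nm}}:\mathcal{L}\to E_\infty$ the nonmarker section. Then the assignment sending each $p\in\widetilde M$, lying in the leaf $\lambda$ of $\widetilde W^u$, to the endpoint in $\partial_\infty\lambda$ of its forward $\widetilde\varphi$-orbit induces a $\pi_1(M)$-equivariant homeomorphism $$\Phi:\mathcal{O}\to E_\infty\smallsetminus s_{\mathbf{nm}}(\mathcal{L}).$$
   Context: $M$ is atoroidal: $\mathbb{Z}\oplus\mathbb{Z}\nleq\pi_1(M)$. A topological Anosov flow $\varphi$ preserves a pair of topologically transverse 2-dimensional foliations $W^s,W^u$ whose leaves intersect along orbits, such that for all small $\epsilon>0$, writing $W^{s/u}_\epsilon(x)$ for the component containing $x$ of the intersection of the leaf through $x$ with the $\epsilon$-ball: (i) if $y\in W^s_\epsilon(x)$ (resp. $W^u_\epsilon(x)$) there is an increasing homeomorphism $\sigma$ of $\mathbb{R}$ fixing $0$ with $d(\varphi_t(x),\varphi_{\sigma(t)}(y))\to 0$ as $t\to+\infty$ (resp. $-\infty$); (ii) there is $\delta>0$ such that if such $y$ is not on the same $\epsilon$-local orbit as $x$, then for every such $\sigma$ there is $t<0$ (resp. $t>0$) with $d(\varphi_t(x),\varphi_{\sigma(t)}(y))>\delta$.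 Adapted to $W^u$ (always achievable up to orbit equivalence, and assumed throughout): there is a continuous metric on $M$ restricting to a hyperbolic metric on each leaf of $W^u$, orbits of $\varphi$ are geodesics in leaves of $W^u$, and strong unstable leaves are projections of horocycles. Tildes denote lifts to the universal cover $\widetilde M$. $\mathcal{O}=\widetilde M/\widetilde\varphi$ is a plane with induced $\pi_1(M)$-action. $\mathcal{L}=\widetilde M/\widetilde W^u$ is a simply connected, possibly non-Hausdorff 1-manifold. Each leaf $\lambda$ of $\widetilde W^u$ is isometric to $\mathbb{H}^2$ with ideal circle $\partial_\infty\lambda$. $E_\infty=\bigcup_{\lambda\in\mathcal{L}}\partial_\infty\lambda$, topologized so that for each transversal $\tau$ to $\widetilde W^u$ the map from the unit tangent bundle to the leaves along $\tau$ to $E_\infty|_\tau$, sending $(p,v)$ to the forward endpoint of the leafwise geodesic through $p$ tangent to $v$, is a homeomorphism. It is a circle bundle over $\mathcal{L}$ with $\pi_1(M)$-action. All $\widetilde\varphi$-orbits in a leaf $\lambda$ of $\widetilde W^u$ have a common backward endpoint $\theta_\lambda\in\partial_\infty\lambda$; the nonmarker section is $s_{\mathbf{nm}}(\lambda)=\theta_\lambda$. *)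

(* Defs.v *)
From HB Require Import structures.
From mathcomp Require Import all_boot all_order all_algebra generic_quotient lra.
From mathcomp Require Import all_classical all_reals all_analysis.

Set Implicit Arguments.
Unset Strict Implicit.
Unset Printing Implicit Defensive.

Import Order.TTheory GRing.Theory Num.Theory.
Import numFieldNormedType.Exports.

Local Open Scope classical_set_scope.
Local Open Scope ring_scope.
Local Open Scope quotient_scope.

Definition homeo_on (S T : topologicalType) (A : set S) (B : set T)
    (f : S -> T) : Prop :=
  exists g : T -> S,
    [/\ forall x, A x -> B (f x) /\ g (f x) = x,
        forall y, B y -> A (g y) /\ f (g y) = y,
        {within A, continuous f} & {within B, continuous g}].

(* Paths are continuous functions on the whole line, used only on [0, 1]. *)
Definition joined (R : realType) (T : topologicalType) (A : set T) (x y : T) :=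
  exists f : R -> T,
    [/\ continuous f, f 0 = x, f 1 = y & forall t, 0 <= t <= 1 -> A (f t)].

Section Manifolds.
Context {R : realType}.

(* A homeomorphism from the open set [cdom] onto the whole of R^n. *)
Record chart (M : topologicalType) (n : nat) := Chart {
  cdom : set M;
  cmap :> M -> 'rV[R]_n;
  cinv : 'rV[R]_n -> M;
  cdom_open : open cdom;
  cmapK : forall x, cdom x -> cinv (cmap x) = x;
  cinvK : forall v, cdom (cinv v) /\ cmap (cinv v) = v;
  cmap_cont : {within cdom, continuous cmap};
  cinv_cont : continuous cinv }.

(* For n <= 3 a germ of embedding of R^n preserves orientation (has local
   degree 1) if and only if it is isotopic, through germs of embeddings, to the
   identity; this makes sense for homeomorphisms, without derivatives. *)
Definition orientation_preserving_at n (f : 'rV[R]_n -> 'rV[R]_n)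
    (x : 'rV[R]_n) : Prop :=
  exists r : R, 0 < r /\
  exists H : R * 'rV[R]_n -> 'rV[R]_n,
    [/\ {within [set p | 0 <= p.1 <= 1 /\ ball x r p.2], continuous H},
        forall t v w, 0 <= t <= 1 -> ball x r v -> ball x r w ->
          H (t, v) = H (t, w) -> v = w &
        forall v, ball x r v -> H (0, v) = f v /\ H (1, v) = v].

Definition closed_manifold (n : nat) (M : topologicalType) : Prop :=
  [/\ compact [set: M], connected [set: M], hausdorff_space M &
      forall x : M, exists c : chart M n, cdom c x].

Definition orientable_manifold (n : nat) (M : topologicalType) : Prop :=
  exists A : set (chart M n),
    (forall x, exists2 c, A c & cdom c x) /\
    (forall c e x, A c -> A e -> cdom c x -> cdom e x ->
       orientation_preserving_at (e \o cinv c) (c x)).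

Definition sqnorm n (v : 'rV[R]_n) : R := \sum_(i < n) v 0 i ^+ 2.

(* Every bicollared (equivalently, tame) 2-sphere bounds a closed ball; the
   bicollar is the image of an open shell around the unit sphere of R^3. *)
Definition irreducible_manifold (M : topologicalType) : Prop :=
  forall s : 'rV[R]_3 -> M,
    let shell := [set v | 2^-1 < sqnorm v < 2] in
    {within shell, continuous s} -> {in shell &, injective s} ->
    exists b : 'rV[R]_3 -> M,
      let D := [set v | sqnorm v <= 1] in
      let S := [set v | sqnorm v = 1] in
      [/\ {within D, continuous b}, {in D &, injective b} & b @` S = s @` S].

End Manifolds.

Section Foliations.
Context {R : realType} (M : topologicalType).

Definition leaf_coord (v : 'rV[R]_(2 + 1)) : 'rV[R]_2 := lsubmx v.
Definition trans_coord (v : 'rV[R]_(2 + 1)) : R := v 0 ord_max.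
Definition from_coords (z : 'rV[R]_2) (t : R) : 'rV[R]_(2 + 1) :=
  row_mx z (const_mx t).

(* Near every point, the level sets of the [i]-th coordinate of [c] are the
   plaques (= level sets of the last coordinate) of the charts in [A]. *)
Definition transverse_coord (A : set (@chart R M (2 + 1)))
    (c : @chart R M (2 + 1)) (i : 'I_(2 + 1)) : Prop :=
  forall e x, A e -> cdom c x -> cdom e x ->
  exists N : set M,
    [/\ open N, N x, N `<=` cdom c `&` cdom e &
        forall p q, N p -> N q ->
          c p 0 i = c q 0 i <-> trans_coord (e p) = trans_coord (e q)].

Record foliation := Foliation {
  fatlas : set (@chart R M (2 + 1));
  fatlas_cover : forall x, exists2 c, fatlas c & cdom c x;
  fatlas_compat : forall c, fatlas c -> transverse_coord fatlas c ord_max }.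

Variable F : foliation.

Definition same_plaque (x y : M) : Prop :=
  exists c, [/\ fatlas F c, cdom c x, cdom c y &
                trans_coord (c x) = trans_coord (c y)].

Inductive same_leaf (x : M) : M -> Prop :=
| same_leaf_refl : same_leaf x x
| same_leaf_step y z : same_leaf x y -> same_plaque y z -> same_leaf x z.

Definition leaf (x : M) : set M := [set y | same_leaf x y].

Lemma same_leaf_trans x y z : same_leaf x y -> same_leaf y z -> same_leaf x z.
Proof. by move=> xy; elim=> // u v _ xu uv; apply: same_leaf_step xu uv. Qed.

Lemma same_leaf_sym x y : same_leaf x y -> same_leaf y x.
Proof.
elim=> [|u v _ ux [c [Fc cu cv cuv]]]; first exact: same_leaf_refl.
apply: same_leaf_trans ux; apply: (same_leaf_step (same_leaf_refl _)).
by exists c.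
Qed.

(* The tangential orientation is carried by an atlas of foliated charts whose
   leafwise coordinate changes preserve the orientation of R^2. *)
Definition orientable_foliation : Prop :=
  exists A : set (@chart R M (2 + 1)),
    [/\ forall x, exists2 c, A c & cdom c x,
        forall c, A c -> transverse_coord (fatlas F) c ord_max &
        forall c e x, A c -> A e -> cdom c x -> cdom e x ->
          orientation_preserving_at
            (fun z => leaf_coord (e (cinv c
                        (from_coords z (trans_coord (c x))))))
            (leaf_coord (c x))].

End Foliations.
Arguments foliation {R} M.

Definition topologically_transverse (R : realType) (M : topologicalType)
    (F G : @foliation R M) : Prop :=
  forall x, exists c : @chart R M (2 + 1),
    [/\ cdom c x, transverse_coord (fatlas F) c ord0 &
        transverse_coord (fatlas G) c (inord 1)].

Record flow (R : realType) (T : topologicalType) := Flow {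
  flow_fun :> R -> T -> T;
  flow0 : forall x, flow_fun 0 x = x;
  flowD : forall s t x, flow_fun (s + t) x = flow_fun s (flow_fun t x);
  flow_cont : continuous (fun p : R * T => flow_fun p.1 p.2) }.
Arguments flow R T : clear implicits.

Section Orbits.
Context {R : realType} {T : topologicalType} (phi : flow R T).

Definition flow_orbit (x : T) : set T := range (fun t => phi t x).

Definition orbit_rel (x y : T) : bool := `[< flow_orbit x y >].

Lemma orbit_rel_refl : reflexive orbit_rel.
Proof. by move=> x; apply/asboolP; exists 0 => //; rewrite flow0. Qed.

Lemma orbit_rel_sym : symmetric orbit_rel.
Proof.
move=> x y; apply: asbool_equiv_eq.
by split=> -[t _ <-]; exists (- t) => //; rewrite -flowD addNr flow0.
Qed.

Lemma orbit_rel_trans : transitive orbit_rel.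
Proof.
move=> y x z /asboolP[s _ <-] /asboolP[t _ <-]; apply/asboolP.
by exists (t + s) => //; rewrite flowD.
Qed.

Canonical orbit_equiv :=
  EquivRel orbit_rel orbit_rel_refl orbit_rel_sym orbit_rel_trans.

Definition orbit_space : Type := quotient_topology {eq_quot orbit_equiv}.

Definition orbit_of (x : T) : orbit_space :=
  \pi_{eq_quot orbit_equiv} x.

End Orbits.

Definition reparametrization (R : realType) (s : R -> R) : Prop :=
  [/\ continuous s, {homo s : a b / a < b}, range s = setT & s 0 = 0].

Section Anosov.
Context {R : realType} {M : metricType R} (phi : flow R M).

Definition local_leaf (F : @foliation R M) (e : R) (x : M) : set M :=
  connected_component (leaf F x `&` ball x e) x.

Definition local_orbit (e : R) (x : M) : set M :=
  connected_component (flow_orbit phi x `&` ball x e) x.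

Definition asymptotic_via (E : set_system R) (x y : M) (s : R -> R) : Prop :=
  reparametrization s /\
  (fun t => mdist (phi t x) (phi (s t) y)) @ E --> (0 : R).

(* [E] is the end of the orbits at which they converge, [P] the set of times at
   which they separate. *)
Definition asymptotic_leaves (F : @foliation R M) (E : set_system R)
    (P : set R) (e : R) : Prop :=
  (forall x y, local_leaf F e x y -> exists s, asymptotic_via E x y s) /\
  (exists2 delta : R, 0 < delta &
     forall x y, local_leaf F e x y -> ~ local_orbit e x y ->
     forall s, asymptotic_via E x y s ->
     exists2 t, P t & delta < mdist (phi t x) (phi (s t) y)).

Definition anosov (Ws Wu : @foliation R M) : Prop :=
  [/\ topologically_transverse Ws Wu,
      forall x, joined R (leaf Ws x `&` leaf Wu x) x = flow_orbit phi x &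
      exists2 e0 : R, 0 < e0 & forall e, 0 < e < e0 ->
        asymptotic_leaves Ws +oo [set t | t < 0] e /\
        asymptotic_leaves Wu -oo [set t | 0 < t] e].

End Anosov.

Definition covering (X M : topologicalType) (pi : X -> M) : Prop :=
  [/\ continuous pi, range pi = setT &
      forall m, exists U : set M, [/\ open U, U m &
      exists V : set (set X),
        [/\ \bigcup_(A in V) A = pi @^-1` U,
            forall A B, V A -> V B -> A `&` B !=set0 -> A = B &
            forall A, V A -> open A /\ homeo_on A U pi]]].

Definition simply_connected (R : realType) (X : topologicalType) : Prop :=
  [/\ [set: X] !=set0,
      forall x y : X, joined R setT x y &
      forall f : R -> X, continuous f -> f 0 = f 1 ->
      exists H : R * R -> X, continuous H /\
        forall t, 0 <= t <= 1 ->
          [/\ H (0, t) = f t, H (1, t) = f 0, H (t, 0) = f 0 & H (t, 1) = f 0]].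

Definition universal_cover (R : realType) (X M : topologicalType)
    (pi : X -> M) : Prop :=
  covering pi /\ simply_connected R X.

(* The fundamental group of M acts on, and is identified with, the deck
   transformations of the universal cover. *)
Record deck (X M : topologicalType) (pi : X -> M) := Deck {
  deck_fun :> X -> X;
  deck_inv : X -> X;
  deckK : cancel deck_fun deck_inv;
  deckVK : cancel deck_inv deck_fun;
  deck_cont : continuous deck_fun;
  deck_inv_cont : continuous deck_inv;
  deck_pi : forall x, pi (deck_fun x) = pi x }.

Definition atoroidal (X M : topologicalType) (pi : X -> M) : Prop :=
  ~ exists rho : int * int -> deck pi,
      (forall a b, rho (a + b) =1 rho a \o rho b) /\
      (forall a b, rho a =1 rho b -> a = b).

Definition lifted_flow (R : realType) (X M : topologicalType) (pi : X -> M)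
    (phi : flow R M) (lphi : flow R X) : Prop :=
  forall t x, pi (lphi t x) = phi t (pi x).

Section Joined.
Context {R : realType} {T : topologicalType}.
Implicit Types (A : set T) (x y z : T).

Lemma joined_refl A x : A x -> joined R A x x.
Proof. by move=> Ax; exists (fun=> x); split=> // t; exact: cvg_cst. Qed.

Lemma joined_sym A x y : joined R A x y -> joined R A y x.
Proof.
move=> [f [cf f0 f1 Af]]; exists (fun t => f (1 - t)); split.
- move=> t; apply: (@continuous_comp _ _ _ (fun t : R => 1 - t) f); last exact: cf.
  by apply: continuousB; [exact: cst_continuous | by move=> ?].
- by rewrite subr0.
- by rewrite subrr.
- by move=> t /andP[t0 t1]; apply: Af; rewrite subr_ge0 t1 gerBl t0.
Qed.

Lemma joined_trans A x y z :
  joined R A x y -> joined R A y z -> joined R A x z.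
Proof.
move=> [f [cf f0 f1 Af]] [g [cg g0 g1 Ag]].
pose p (t : R) := f (2 * t); pose q (t : R) := g (2 * t - 1).
have cp : continuous p.
  move=> t; apply: (@continuous_comp _ _ _ (fun t : R => 2 * t) f); last exact: cf.
  exact: mulrl_continuous.
have cq : continuous q.
  move=> t; apply: (@continuous_comp _ _ _ (fun t : R => 2 * t - 1) g);
    last exact: cg.
  apply: continuousB; [exact: mulrl_continuous | exact: cst_continuous].
pose h (t : R) := if t <= 2^-1 then p t else q t.
have E : [set t : R | t <= 2^-1] `|` [set t : R | 2^-1 <= t] = setT.
  by rewrite predeqE => t; split=> // _; case/orP: (le_total t 2^-1); [left|right].
exists h; split.
- apply/continuous_subspace_setT; rewrite -E.
  apply: withinU_continuous; [exact: closed_le | exact: closed_ge | |].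
  + apply: (@subspace_eq_continuous _ _ _ p); last exact: continuous_subspaceT.
    by move=> t; rewrite inE => /= t2; rewrite /from_subspace /h t2.
  + apply: (@subspace_eq_continuous _ _ _ q); last exact: continuous_subspaceT.
    move=> t; rewrite inE => /= t2; rewrite /from_subspace /h; case: ifPn => // t2'.
    have -> : t = 2^-1 by apply/eqP; rewrite eq_le t2' t2.
    by rewrite /p /q mulfV ?pnatr_eq0// subrr f1 g0.
- by rewrite /h invr_ge0 ler0n /p mulr0.
- rewrite /h ifF; first by rewrite /q mulr1 (_ : 2 - 1 = 1) // (natrD R 1 1) addrK.
  by apply/negbTE; rewrite -ltNge invf_lt1 ?ltr1n.
- move=> t /andP[t0 t1]; rewrite /h; case: ifPn => t2.
    by apply: Af; lra.
  by apply: Ag; rewrite -ltNge in t2; lra.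
Qed.

End Joined.

Section LeafSpace.
Context {R : realType} {X M : topologicalType} (pi : X -> M).
Variable F : @foliation R M.

(* Leaves of the lifted foliation are the path components of the preimages of
   the leaves. *)
Definition lifted_leaf (x : X) : set X :=
  joined R (pi @^-1` leaf F (pi x)) x.

Lemma lifted_leaf_refl x : lifted_leaf x x.
Proof. by apply: joined_refl; exact: same_leaf_refl. Qed.

Lemma lifted_leaf_leaf x y : lifted_leaf x y -> leaf F (pi x) = leaf F (pi y).
Proof.
move=> [f [_ _ <- /(_ 1)]]; rewrite ler01 lexx => /(_ isT) /= xy.
rewrite predeqE => z; split; last exact: same_leaf_trans.
by apply: same_leaf_trans; exact: same_leaf_sym.
Qed.

Lemma lifted_leaf_sym x y : lifted_leaf x y -> lifted_leaf y x.
Proof.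
by move=> xy; rewrite /lifted_leaf -(lifted_leaf_leaf xy); exact: joined_sym.
Qed.

Lemma lifted_leaf_trans x y z :
  lifted_leaf x y -> lifted_leaf y z -> lifted_leaf x z.
Proof.
move=> xy; rewrite /lifted_leaf -(lifted_leaf_leaf xy).
exact: joined_trans.
Qed.

Lemma lifted_leaf_deck (g : deck pi) x y :
  lifted_leaf x y -> lifted_leaf (g x) (g y).
Proof.
move=> [f [cf f0 f1 Ff]]; exists (g \o f); split=> /=.
- by move=> t; apply: continuous_comp; [exact: cf | exact: deck_cont].
- by rewrite f0.
- by rewrite f1.
- by move=> t t01; rewrite !deck_pi; exact: Ff.
Qed.

Definition lifted_leaf_rel (x y : X) : bool := `[< lifted_leaf x y >].

Lemma lifted_leaf_rel_refl : reflexive lifted_leaf_rel.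
Proof. by move=> x; apply/asboolP; exact: lifted_leaf_refl. Qed.

Lemma lifted_leaf_rel_sym : symmetric lifted_leaf_rel.
Proof.
by move=> x y; apply: asbool_equiv_eq; split; exact: lifted_leaf_sym.
Qed.

Lemma lifted_leaf_rel_trans : transitive lifted_leaf_rel.
Proof.
move=> y x z /asboolP xy /asboolP yz; apply/asboolP.
exact: lifted_leaf_trans xy yz.
Qed.

Canonical lifted_leaf_equiv := EquivRel lifted_leaf_rel
  lifted_leaf_rel_refl lifted_leaf_rel_sym lifted_leaf_rel_trans.

Definition leaf_space : Type := quotient_topology {eq_quot lifted_leaf_equiv}.

(* A compact arc topologically transverse to the lifted foliation: it is
   locally injective in the transverse coordinate of foliated charts. *)
Definition leaf_transversal (tau : R -> X) : Prop :=
  [/\ continuous tau, {in `[0, 1]%classic &, injective tau} &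
      forall t, 0 <= t <= 1 ->
      exists c, [/\ fatlas F c, cdom c (pi (tau t)) &
      exists2 e : R, 0 < e &
        {in [set s | 0 <= s <= 1 /\ `|s - t| < e] &,
          injective (fun s => trans_coord (c (pi (tau s))))} /\
        (forall s, 0 <= s <= 1 -> `|s - t| < e -> cdom c (pi (tau s)))]].

(* The leafwise distance functions of a leafwise metric on M, lifted to the
   universal cover; [ldist x y] is meaningful only for x and y in one leaf. *)
Record leaf_metric := LeafMetric {
  ldist :> X -> X -> R;
  ldist_ge0 : forall x y, lifted_leaf x y -> 0 <= ldist x y;
  ldist_eq0 : forall x y, lifted_leaf x y -> ldist x y = 0 <-> x = y;
  ldist_sym : forall x y, lifted_leaf x y -> ldist x y = ldist y x;
  ldist_triangle : forall x y z, lifted_leaf x y -> lifted_leaf y z ->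
    ldist x z <= ldist x y + ldist y z;
  ldist_deck : forall (g : deck pi) x y, lifted_leaf x y ->
    ldist (g x) (g y) = ldist x y }.

End LeafSpace.

Section HyperbolicPlane.
Context {R : realType}.

Definition upper_half_plane : set (R * R) := [set z | 0 < z.2].

(* arcosh (1 + |z - w|^2 / (2 Im z Im w)) *)
Definition hyp_dist (z w : R * R) : R :=
  let c := 1 + ((z.1 - w.1) ^+ 2 + (z.2 - w.2) ^+ 2) / (2 * z.2 * w.2) in
  ln (c + Num.sqrt (c ^+ 2 - 1)).

End HyperbolicPlane.

Section Boundary.
Context {R : realType} {X M : topologicalType} { pi : X -> M}.
Context {F : @foliation R M} (D : leaf_metric pi F).

Definition leaf_isometry (x : X) (h : R * R -> X) : Prop :=
  [/\ {within upper_half_plane, continuous h},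
      h @` upper_half_plane = lifted_leaf pi F x &
      forall z w, upper_half_plane z -> upper_half_plane w ->
        D (h z) (h w) = hyp_dist z w].

(* Isometries of the hyperbolic plane act transitively on horocycles, so every
   horocycle is the line Im z = 1 in a suitable half-plane coordinate. *)
Definition horocycle (x : X) (S : set X) : Prop :=
  exists2 h, leaf_isometry x h & S = h @` [set z | z.2 = 1].

Definition geodesic (v : {compact-open, R -> X}) : Prop :=
  forall s t, lifted_leaf pi F (v s) (v t) /\ D (v s) (v t) = `|s - t|.

(* Unit tangent vectors to the leaves: the vector tangent at [v 0] to a complete
   unit speed leafwise geodesic [v] is represented by [v]. *)
Definition unit_tangent : Type := set_type [set v | geodesic v].

Definition line (v : unit_tangent) : R -> X := \val v.

Lemma line_geodesic v : geodesic (line v).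
Proof. exact: set_mem (valP v). Qed.

Definition mk_unit_tangent (v : R -> X) (gv : geodesic v) : unit_tangent :=
  exist _ v (mem_set gv).

Lemma line_leaf v s t : lifted_leaf pi F (line v s) (line v t).
Proof. by case: (line_geodesic v s t). Qed.

Definition asymptotic (v w : unit_tangent) : Prop :=
  lifted_leaf pi F (line v 0) (line w 0) /\
  exists B : R, forall t, 0 <= t -> D (line v t) (line w t) <= B.

Lemma asymptotic_leaf v w s t :
  asymptotic v w -> lifted_leaf pi F (line v s) (line w t).
Proof.
move=> [vw _]; apply: lifted_leaf_trans (line_leaf v s 0) _.
exact: lifted_leaf_trans vw (line_leaf w 0 t).
Qed.

Definition asymptotic_rel (v w : unit_tangent) : bool := `[< asymptotic v w >].

Lemma asymptotic_rel_refl : reflexive asymptotic_rel.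
Proof.
move=> v; apply/asboolP; split; first exact: line_leaf.
exists 0 => t _; have [_ ->] := line_geodesic v t t.
by rewrite subrr normr0.
Qed.

Lemma asymptotic_rel_sym : symmetric asymptotic_rel.
Proof.
suff H v w : asymptotic v w -> asymptotic w v.
  by move=> v w; apply: asbool_equiv_eq; split; exact: H.
move=> vw; case: (vw) => vw0 [B vwB]; split; first exact: lifted_leaf_sym.
exists B => t t0; rewrite ldist_sym; first exact: vwB.
exact/lifted_leaf_sym/asymptotic_leaf.
Qed.

Lemma asymptotic_rel_trans : transitive asymptotic_rel.
Proof.
move=> v u w /asboolP uv /asboolP vw; apply/asboolP.
case: (uv) (vw) => uv0 [B uvB] [vw0 [C vwC]].
split; first exact: lifted_leaf_trans uv0 vw0.
exists (B + C) => t t0.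
apply: le_trans (ldist_triangle D (asymptotic_leaf t t uv)
  (asymptotic_leaf t t vw)) _.
by rewrite lerD ?uvB ?vwC.
Qed.

Canonical asymptotic_equiv := EquivRel asymptotic_rel
  asymptotic_rel_refl asymptotic_rel_sym asymptotic_rel_trans.

(* The union of the ideal circles of all leaves: since asymptotic geodesics lie
   in one leaf, a class is a point at infinity of a single leaf. *)
Definition Einf : Type := {eq_quot asymptotic_equiv}.
HB.instance Definition _ := Choice.on Einf.
HB.instance Definition _ := Quotient.on Einf.

Definition forward_end (v : unit_tangent) : Einf := \pi_Einf v.

Definition unit_tangent_along (tau : R -> X) : set unit_tangent :=
  [set v | (tau @` `[0, 1]) (line v 0)].

Definition end_along (tau : R -> X) (v : set_type (unit_tangent_along tau)) :
  Einf := forward_end (\val v).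

(* The topology determined by the trivializations [end_along tau]: the coherent
   (finest) topology for which all of them are continuous. *)
Definition Einf_open (U : set Einf) : Prop :=
  forall tau, leaf_transversal pi F tau -> open (@end_along tau @^-1` U).

Lemma Einf_openT : Einf_open setT.
Proof. by move=> tau _; exact: openT. Qed.

Lemma Einf_openI (U V : set Einf) :
  Einf_open U -> Einf_open V -> Einf_open (U `&` V).
Proof.
by move=> oU oV tau Ht; rewrite preimage_setI; apply: openI; [exact: oU | exact: oV].
Qed.

Lemma Einf_open_bigU (I : Type) (f : I -> set Einf) :
  (forall i, Einf_open (f i)) -> Einf_open (\bigcup_i f i).
Proof.
move=> of_ tau Ht; rewrite preimage_bigcup.
by apply: bigcup_open => i _; exact: of_.
Qed.

HB.instance Definition _ :=
  isOpenTopological.Build Einf Einf_openT Einf_openI Einf_open_bigU.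

Lemma deck_geodesic (g : deck pi) (v : unit_tangent) : geodesic (g \o line v).
Proof.
move=> s t /=; split; first by apply: lifted_leaf_deck; exact: line_leaf.
by rewrite ldist_deck; [case: (line_geodesic v s t) | exact: line_leaf].
Qed.

Definition deck_unit_tangent (g : deck pi) (v : unit_tangent) : unit_tangent :=
  mk_unit_tangent (deck_geodesic g v).

Definition deck_Einf (g : deck pi) (xi : Einf) : Einf :=
  forward_end (deck_unit_tangent g (repr xi)).

Lemma deck_EinfE g v :
  deck_Einf g (forward_end v) = forward_end (deck_unit_tangent g v).
Proof.
apply/eqmodP/asboolP.
have /asboolP : asymptotic_rel (repr (forward_end v)) v.
  by apply/(@eqmodP _ asymptotic_equiv); rewrite reprK.
case=> v0 [B vB]; split; first exact: lifted_leaf_deck.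
exists B => t t0; rewrite /line /= ldist_deck; first exact: vB.
apply: asymptotic_leaf; split=> //; by exists B.
Qed.

Lemma reverse_geodesic (v : unit_tangent) : geodesic (fun t => line v (- t)).
Proof.
move=> s t; have [? ->] := line_geodesic v (- s) (- t); split=> //.
by rewrite -opprD normrN.
Qed.

Definition backward_end (v : unit_tangent) : Einf :=
  forward_end (mk_unit_tangent (reverse_geodesic v)).

End Boundary.

Section Adapted.
Context {R : realType} {X M : topologicalType} { pi : X -> M}.
Context {F : @foliation R M} (lphi : flow R X) (D : leaf_metric pi F).

(* [v] is the orbit of [x], parametrized by arc length in the direction of the
   flow. *)
Definition orbit_geodesic (x : X) (v : unit_tangent D) : Prop :=
  exists2 s, reparametrization s & forall t, line v t = lphi (s t) x.

Definition strong_leaf (x : X) : set X :=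
  [set y | lifted_leaf pi F x y /\
           (fun t => D (lphi t x) (lphi t y)) @ -oo --> (0 : R)].

(* All conditions are expressed on the universal cover. Continuity of the metric
   on M becomes continuity of the lifted leafwise distance on pairs of points of
   one leaf; the strong leaves of M are the projections of [strong_leaf x]. *)
Record adapted : Prop := Adapted {
  adapted_continuous :
    {within [set p : X * X | lifted_leaf pi F p.1 p.2],
      continuous (fun p => D p.1 p.2)};
  adapted_hyperbolic : forall x, exists h, leaf_isometry D x h;
  adapted_geodesic : forall x, exists v, orbit_geodesic x v;
  adapted_horocycle : forall x, horocycle D x (strong_leaf x) }.

Hypothesis ad : adapted.

Definition orbit_line (x : X) : unit_tangent D :=
  sval (cid (adapted_geodesic ad x)).

Definition forward_endpoint (x : X) : Einf D := forward_end (orbit_line x).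

(* The backward endpoint of the orbit of a representative of the leaf; all
   orbits in a leaf have the same one. *)
Definition nonmarker (l : leaf_space pi F) : Einf D :=
  backward_end (orbit_line (repr l)).

End Adapted.

(* Main.v *)
Require Import Defs.
From HB Require Import structures.
From mathcomp Require Import all_boot all_order all_algebra generic_quotient.
From mathcomp Require Import all_classical all_reals all_analysis.
From mathcomp Require Import ring lra.

Set Implicit Arguments.
Unset Strict Implicit.
Unset Printing Implicit Defensive.

Import Order.TTheory GRing.Theory Num.Theory.
Import numFieldNormedType.Exports.

Local Open Scope classical_set_scope.
Local Open Scope ring_scope.

(* Leaves of the lifted unstable foliation are isometric copies of the upper
   half-plane H. In the hyperboloid model a unit speed geodesic is
   t |-> e^t A + e^-t C with A and C null vectors, its ends being the
   directions of A and C. Since strong unstable leaves are horocycles, a leaf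
   has a coordinate in H in which every orbit is t |-> (a, b e^-t): the
   nonmarker point is at infinity, and an orbit is the same thing as a real
   ideal point a. This gives the bijection.

   For the topology, two facts link nearby leaves: points that are close along
   a leaf are close in the universal cover, uniformly over nearby leaves
   (a path in a leaf cannot leave its plaque inside a box, because a leaf has
   countably many plaques), and the unit speed flow is continuous. Continuity of
   Phi follows because the geodesics from a transversal asymptotic to the orbits
   of nearby points stay close to these orbits on compact time intervals.
   Conversely, a geodesic v with a real end is almost tangent to the flow at a
   large time T; the same holds for every v' close to v, and then the orbit
   ending at the end of v' passes near v'(T). *)

(** * Geodesics of the half-plane *)

Section HalfPlane.
Context {R : realType}.
Implicit Types (z w : R * R) (s t : R).

(** The half-plane coordinates of different leaves are chosen separately and do not vary
    continuously with the leaf. Only three things pass from one leaf to the next: the topology of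
    [X], the joint continuity of [D] on leafwise pairs, and the unit speed flow. An estimate made in
    the chart of one leaf is therefore carried to nearby leaves as a strict inequality between such
    quantities. Distances enter through twice their hyperbolic cosine, a rational function of the
    coordinates, which turns comparisons into algebra. An open set of [Einf] is tested only on
    vectors based on a transversal. This is why continuity of Phi needs geodesics based there in
    place of the orbits themselves; openness is proved in a stronger form, on all unit vectors at
    once. *)

Definition dcosh t : R := expR t + expR (- t).

Lemma dcoshN t : dcosh (- t) = dcosh t.
Proof. by rewrite /dcosh opprK addrC. Qed.

Lemma dcosh_norm t : dcosh `|t| = dcosh t.
Proof. by case: (ger0P t) => _ //; rewrite dcoshN. Qed.

Lemma dcosh0 : dcosh 0 = 2.
Proof. by rewrite /dcosh oppr0 expR0. Qed.

Lemma ler_dcosh s t : 0 <= s -> 0 <= t -> (dcosh s <= dcosh t) = (s <= t).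
Proof.
move=> s0 t0; rewrite -[s <= t]ler_expR /dcosh !expRN.
have : 1 <= expR s by rewrite -expR0 ler_expR.
have : 1 <= expR t by rewrite -expR0 ler_expR.
move: (expR s) (expR t) => u v v1 u1.
have E : v + v^-1 - (u + u^-1) = (v - u) * (1 - (u * v)^-1) by field; lra.
have uv : (u * v)^-1 <= 1 by rewrite invf_le1; nra.
apply/idP/idP => [|le_uv]; last by nra.
case: (lerP u v) => // vu le_uv.
have uv1 : (u * v)^-1 < 1 by rewrite invf_lt1; nra.
by nra.
Qed.

Lemma ltr_dcosh s t : 0 <= s -> 0 <= t -> (dcosh s < dcosh t) = (s < t).
Proof. by move=> s0 t0; rewrite ltNge ler_dcosh// -ltNge. Qed.

Lemma dcosh_inj s t : 0 <= s -> 0 <= t -> dcosh s = dcosh t -> s = t.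
Proof.
by move=> s0 t0 E; apply: le_anti; rewrite -(ler_dcosh s0 t0) -(ler_dcosh t0 s0) E lexx.
Qed.

Lemma dcosh_gt2 t : 0 < t -> 2 < dcosh t.
Proof. by move=> t0; rewrite -dcosh0 ltr_dcosh// ltW. Qed.

Lemma dcosh_le_ln t K : dcosh t <= K -> t <= ln K.
Proof.
move=> tK; have tK' : expR t <= K by apply: le_trans tK; rewrite lerDl expR_ge0.
by rewrite -[t]expRK ler_ln// posrE ?expR_gt0// (lt_le_trans (expR_gt0 t)).
Qed.

(* Twice the hyperbolic cosine of the distance: minus twice the Lorentzian
   product of the images of [z] and [w] in the hyperboloid model. *)
Definition hyp_form z w : R :=
  ((z.1 - w.1) ^+ 2 + z.2 ^+ 2 + w.2 ^+ 2) / (z.2 * w.2).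

Lemma hyp_form_ge2 z w : 0 < z.2 -> 0 < w.2 -> 2 <= hyp_form z w.
Proof.
move=> z0 w0; rewrite /hyp_form ler_pdivlMr; last exact: mulr_gt0.
by have := sqr_ge0 (z.1 - w.1); have := sqr_ge0 (z.2 - w.2); nra.
Qed.

Lemma hyp_distE z w : hyp_dist z w =
  let c := 1 + ((z.1 - w.1) ^+ 2 + (z.2 - w.2) ^+ 2) / (2 * z.2 * w.2) in
  ln (c + Num.sqrt (c ^+ 2 - 1)).
Proof. by []. Qed.

Lemma hyp_distP z w : 0 < z.2 -> 0 < w.2 ->
  0 <= hyp_dist z w /\ dcosh (hyp_dist z w) = hyp_form z w.
Proof.
move=> z0 w0; rewrite hyp_distE /=.
set c := 1 + _.
have E : hyp_form z w = 2 * c by rewrite /c /hyp_form; field; lra.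
have c1 : 1 <= c by have := hyp_form_ge2 z0 w0; lra.
have s0 : 0 <= Num.sqrt (c ^+ 2 - 1) by exact: sqrtr_ge0.
have s2 : Num.sqrt (c ^+ 2 - 1) ^+ 2 = c ^+ 2 - 1 by rewrite sqr_sqrtr//; nra.
move: s0 s2; set s := Num.sqrt _ => s0 s2.
split; first by rewrite ln_ge0//; lra.
rewrite /dcosh expRN lnK ?posrE; last by lra.
have -> : (c + s)^-1 = c - s.
  by apply: (@mulfI _ (c + s)); [lra | rewrite mulfV; [nra | lra]].
lra.
Qed.

Lemma hyp_dist_eq z w r : 0 < z.2 -> 0 < w.2 -> 0 <= r ->
  hyp_form z w = dcosh r -> hyp_dist z w = r.
Proof.
move=> z0 w0 r0; have [d0 <-] := hyp_distP z0 w0; exact: dcosh_inj.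
Qed.

(* In the hyperboloid model [gamma] is [t |-> e^t A + e^-t C] with [A] and [C]
   the null vectors [(ga, gp, gq)] and [(gb, gr, gs)]; the ends of the geodesic
   are [gp / ga] and [gr / gb]. *)
Record geodesic_coefs (gamma : R -> R * R) (a p q b r s : R) : Prop := {
  gc_inv : forall t, (gamma t).2^-1 = a * expR t + b * expR (- t);
  gc_mid : forall t, (gamma t).1 / (gamma t).2 = p * expR t + r * expR (- t);
  gc_sqr : forall t, ((gamma t).1 ^+ 2 + (gamma t).2 ^+ 2) / (gamma t).2 =
     q * expR t + s * expR (- t);
  gc_ge0 : [/\ 0 <= a, 0 <= b, 0 <= q & 0 <= s];
  gc_nullA : a * q = p ^+ 2;
  gc_nullC : b * s = r ^+ 2;
  gc_AC : a * s + q * b - 2 * p * r = 1 }.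

Lemma exp_comb_ge0 (a b : R) :
  (forall t, 0 < a * expR t + b * expR (- t)) -> 0 <= a.
Proof.
move=> H; rewrite leNgt; apply/negP => a0.
(* Chosen so that [a * (1 + t) = a - |b| - 1]; this bounds [a * expR t] from above, while
   [b * expR (- t)] is at most [|b|], and the sum is negative. *)
pose t := (`|b| + 1) / - a.
have t1 : 0 <= t by rewrite /t divr_ge0//; lra.
have := H t; have := expR_ge1Dx t; rewrite expRN.
have et : 1 <= expR t by rewrite -expR0 ler_expR.
have : (expR t)^-1 <= 1 by rewrite invf_le1//; lra.
have : 0 < (expR t)^-1 by rewrite invr_gt0; lra.
move: (expR t) ((expR t)^-1) et => u v u1 v0 v1 ut.
have at_ : a * t = - (`|b| + 1) by rewrite /t; field; lra.
have au : a * u <= a * (1 + t) by rewrite ler_nM2l.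
have bv : b * v <= `|b| * v by rewrite ler_pM2r// ler_norm.
have bv' : `|b| * v <= `|b| by rewrite ler_piMr.
lra.
Qed.

(** [U], [P], [Q] are the hyperboloid coordinates of the curve, and the hypothesis prescribes all
    Lorentzian products of its points. These determine the curve from two of its points, so no
    continuity or derivative is involved. *)
Lemma exp_line (gamma : R -> R * R) : (forall t, 0 < (gamma t).2) ->
  (forall s t, hyp_form (gamma s) (gamma t) = dcosh (s - t)) ->
  exists a p q b r s, geodesic_coefs gamma a p q b r s.
Proof.
move=> g0 gB.
pose U t := (gamma t).2^-1; pose P t := (gamma t).1 / (gamma t).2.
pose Q t := ((gamma t).1 ^+ 2 + (gamma t).2 ^+ 2) / (gamma t).2.
have B s t : U s * Q t + Q s * U t - 2 * P s * P t = dcosh (s - t).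
  rewrite -gB /U /P /Q /hyp_form; have := g0 s; have := g0 t.
  by move=> ? ?; field; lra.
pose e := expR 1 : R; pose f := expR (-1) : R.
have ef : e * f = 1 by rewrite /e /f -expRD subrr expR0.
have e1 : 1 < e by rewrite /e expR_gt1.
have f0 : 0 < f by rewrite expR_gt0.
have f1 : f < 1 by nra.
pose d := (e - f)^-1.
have dE : d * (e - f) = 1 by rewrite mulVf//; lra.
(* [cA] and [cC] solve [V t = A * expR t + C * expR (- t)] at [t = 0] and [t = 1]. *)
pose cA (V : R -> R) := d * (V 1 - f * V 0).
pose cC (V : R -> R) := d * (e * V 0 - V 1).
have BA s : cA U * Q s + cA Q * U s - 2 * cA P * P s = expR (- s).
  have -> : cA U * Q s + cA Q * U s - 2 * cA P * P s =
    d * ((U 1 * Q s + Q 1 * U s - 2 * P 1 * P s) -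
         f * (U 0 * Q s + Q 0 * U s - 2 * P 0 * P s)) by rewrite /cA; ring.
  rewrite !B /dcosh sub0r opprK opprB expRD (addrC s) expRD -/e -/f.
  transitivity (d * (e - f) * expR (- s)); first by ring.
  by rewrite dE mul1r.
have BC s : cC U * Q s + cC Q * U s - 2 * cC P * P s = expR s.
  have -> : cC U * Q s + cC Q * U s - 2 * cC P * P s =
    d * (e * (U 0 * Q s + Q 0 * U s - 2 * P 0 * P s)
         - (U 1 * Q s + Q 1 * U s - 2 * P 1 * P s)) by rewrite /cC; ring.
  rewrite !B /dcosh sub0r opprK opprB expRD (addrC s) expRD -/e -/f.
  transitivity (d * (e - f) * expR s); first by ring.
  by rewrite dE mul1r.
(* The error [Z] is orthogonal to every point of the curve, hence to itself, being a combination of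
   such points. A null vector orthogonal to the timelike vector at time 0 vanishes. *)
pose Z (V : R -> R) t := V t - (cA V * expR t + cC V * expR (- t)).
have BZ t s : Z U t * Q s + Z Q t * U s - 2 * Z P t * P s = 0.
  have -> : Z U t * Q s + Z Q t * U s - 2 * Z P t * P s =
    (U t * Q s + Q t * U s - 2 * P t * P s) -
    ((cA U * Q s + cA Q * U s - 2 * cA P * P s) * expR t +
     (cC U * Q s + cC Q * U s - 2 * cC P * P s) * expR (- t)).
    by rewrite /Z; ring.
  by rewrite B BA BC /dcosh opprB !expRD; ring.
have ZZ t V : Z V t = V t - (d * (V 1 - f * V 0) * expR t +
     d * (e * V 0 - V 1) * expR (- t)) by [].
have BZZ t : Z U t * Z Q t - Z P t ^+ 2 = 0.
  have E : 2 * (Z U t * Z Q t - Z P t ^+ 2) =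
    Z U t * Q t + Z Q t * U t - 2 * Z P t * P t -
    d * expR t * ((Z U t * Q 1 + Z Q t * U 1 - 2 * Z P t * P 1) -
      f * (Z U t * Q 0 + Z Q t * U 0 - 2 * Z P t * P 0)) -
    d * expR (- t) * (e * (Z U t * Q 0 + Z Q t * U 0 - 2 * Z P t * P 0) -
      (Z U t * Q 1 + Z Q t * U 1 - 2 * Z P t * P 1)).
    by rewrite /Z /cA /cC; ring.
  by rewrite !BZ in E; lra.
have Z0 t : [/\ Z U t = 0, Z P t = 0 & Z Q t = 0].
  have := BZ t 0; have := BZZ t; have := g0 0.
  rewrite /U /P /Q; move: (gamma 0) (Z U t) (Z P t) (Z Q t) => [x y] /= u p q y0.
  move=> uq /(congr1 (fun r => r * y)).
  have -> : (u * ((x ^+ 2 + y ^+ 2) / y) + q / y - 2 * p * (x / y)) * y =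
    u * (x ^+ 2 + y ^+ 2) + q - 2 * p * x by field; lra.
  rewrite mul0r => qE.
  have sq : (p - u * x) ^+ 2 + (u * y) ^+ 2 = 0.
    have qE' : q = 2 * p * x - u * (x ^+ 2 + y ^+ 2) by lra.
    by rewrite -[RHS]oppr0 -uq qE'; ring.
  have uy : u * y = 0.
    apply/eqP; rewrite -sqrf_eq0; apply/eqP.
    by have := sqr_ge0 (p - u * x); have := sqr_ge0 (u * y); lra.
  have u0 : u = 0 by move/eqP: uy; rewrite mulf_eq0 (gt_eqF y0) orbF => /eqP.
  have p0 : p = 0.
    move: sq; rewrite u0 !mul0r subr0 expr0n addr0 => /eqP.
    by rewrite sqrf_eq0 => /eqP.
  by split=> //; rewrite u0 p0 in qE; lra.
have UE t : U t = cA U * expR t + cC U * expR (- t).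
  by have [/subr0_eq] := Z0 t.
have PE t : P t = cA P * expR t + cC P * expR (- t).
  by have [_ /subr0_eq] := Z0 t.
have QE t : Q t = cA Q * expR t + cC Q * expR (- t).
  by have [_ _ /subr0_eq] := Z0 t.
have U0 t : 0 < U t by rewrite invr_gt0.
have Q0 t : 0 < Q t.
  by rewrite /Q divr_gt0// ltr_wpDl ?sqr_ge0// exprn_gt0.
have comb_ge0 V : (forall t, 0 < V t) ->
    (forall t, V t = cA V * expR t + cC V * expR (- t)) -> 0 <= cA V /\ 0 <= cC V.
  move=> V0 VE; split; [apply: (@exp_comb_ge0 _ (cC V))|apply: (@exp_comb_ge0 _ (cA V))] => t.
    by rewrite -VE.
  by have := V0 (- t); rewrite VE opprK addrC.
have [aU0 cU0] := comb_ge0 U U0 UE; have [aQ0 cQ0] := comb_ge0 Q Q0 QE.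
have nA0 := BA 0; have nA1 := BA 1; have nC0 := BC 0.
rewrite !UE !PE !QE oppr0 expR0 -/e -/f in nA0 nA1 nC0.
have e_neq : e - f != 0 by lra.
have nA : cA U * cA Q - cA P ^+ 2 = 0.
  by apply: (mulfI e_neq); rewrite mulr0; nra.
exists (cA U), (cA P), (cA Q), (cC U), (cC P), (cC Q); split=> //; lra.
Qed.

Lemma hyp_form_coefs z w : 0 < z.2 -> 0 < w.2 -> hyp_form z w =
  z.2^-1 * ((w.1 ^+ 2 + w.2 ^+ 2) / w.2) + (z.1 ^+ 2 + z.2 ^+ 2) / z.2 * w.2^-1
  - 2 * (z.1 / z.2) * (w.1 / w.2).
Proof. by move=> z0 w0; rewrite /hyp_form; field; lra. Qed.

(** This circle is the horocycle based at the forward end [p / a], of Euclidean diameter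
    [expR (- t) / a]. *)
Lemma geodesic_coefs_circle gamma a p q b r s t :
  (forall t, 0 < (gamma t).2) -> geodesic_coefs gamma a p q b r s -> 0 < a ->
  ((gamma t).1 - p / a) ^+ 2 + (gamma t).2 ^+ 2 = (gamma t).2 * expR (- t) / a.
Proof.
move=> g0 [gU gP gQ _ nA nC nAC] a0; have y0 := g0 t.
apply: (@mulIf _ (gamma t).2^-1); first by rewrite invr_eq0 gt_eqF.
have -> : (((gamma t).1 - p / a) ^+ 2 + (gamma t).2 ^+ 2) * (gamma t).2^-1 =
  ((gamma t).1 ^+ 2 + (gamma t).2 ^+ 2) / (gamma t).2 -
  2 * (p / a) * ((gamma t).1 / (gamma t).2) + (p / a) ^+ 2 * (gamma t).2^-1.
  by field; lra.
have -> : (gamma t).2 * expR (- t) / a * (gamma t).2^-1 = expR (- t) / a.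
  by field; lra.
rewrite gP gQ gU.
have qE : q = p ^+ 2 / a by rewrite -nA; field; lra.
have sE : s = (1 + 2 * p * r - q * b) / a.
  have -> : 1 + 2 * p * r - q * b = a * s by lra.
  by field; lra.
by rewrite sE qE; field; lra.
Qed.

(** The vertical line descending to the same end stays at bounded distance. The choice [k = a^-1]
    synchronizes the two: the right-hand side then tends to 2, the value at distance 0. *)
Lemma geodesic_coefs_vertical gamma a p q b r s k t :
  (forall t, 0 < (gamma t).2) -> geodesic_coefs gamma a p q b r s ->
  0 < a -> 0 < k ->
  hyp_form (gamma t) (p / a, k * expR (- t)) =
  (k * a)^-1 + k * a + k * b * expR (- t) ^+ 2.
Proof.
move=> g0 [gU gP gQ _ nA nC nAC] a0 k0.
have et : 0 < expR t := expR_gt0 t.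
rewrite hyp_form_coefs//=; last by rewrite mulr_gt0// expR_gt0.
rewrite gP gQ gU expRN; move: (expR t) et => u u0.
have qE : q = p ^+ 2 / a by rewrite -nA; field; lra.
have bE : s = (1 + 2 * p * r - q * b) / a.
  have -> : 1 + 2 * p * r - q * b = a * s by lra.
  by field; lra.
rewrite bE qE; apply/eqP; rewrite -subr_eq0; apply/eqP; field; lra.
Qed.

Lemma le0_exp (c K : R) : (forall t, 0 <= t -> c * expR t <= K) -> c <= 0.
Proof.
move=> H; rewrite leNgt; apply/negP => c0.
have t0 : 0 <= `|K| / c by rewrite divr_ge0// ltW.
have := H _ t0; have := expR_ge1Dx (`|K| / c).
move: (expR _) => u; rewrite -(ler_pM2l c0) mulrDr mulr1 mulrC.
rewrite mulrC (mulrC c (_ / _)) divfK ?gt_eqF// => uK.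
by have := ler_norm K; lra.
Qed.

(** Null vectors of the closed forward cone have a product of constant sign: this is the inequality
    of arithmetic and geometric means for [a * q'] and [q * a'], whose product is
    [(p * p') ^+ 2]. *)
Lemma null_form_ge0 (a p q a' p' q' : R) :
  [/\ 0 <= a, 0 <= q, 0 <= a' & 0 <= q'] -> a * q = p ^+ 2 ->
  a' * q' = p' ^+ 2 -> 0 <= a * q' + q * a' - 2 * p * p'.
Proof.
move=> [a0 q0 a0' q0'] E E'.
have le2 : (p * p') ^+ 2 <= ((a * q' + q * a') / 2) ^+ 2.
  have -> : (p * p') ^+ 2 = (a * q') * (q * a').
    by rewrite exprMn -E -E'; ring.
  have := sqr_ge0 (a * q' - q * a'); nra.
have : p * p' <= (a * q' + q * a') / 2.
  apply: le_trans (ler_norm _) _; rewrite -ler_sqr ?nnegrE//.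
    by rewrite real_normK ?num_real.
  by rewrite divr_ge0// addr_ge0// mulr_ge0.
lra.
Qed.

(** Expanded in exponentials, the form is a sum of four nonnegative terms. The product of the two
    backward null vectors is multiplied by a factor that is unbounded as [u] and [v] tend to -oo, so
    a bound forces it to vanish. *)
Lemma backward_null_form gamma gamma' a p q b r s a' p' q' b' r' s' K :
  (forall t, 0 < (gamma t).2) -> (forall t, 0 < (gamma' t).2) ->
  geodesic_coefs gamma a p q b r s -> geodesic_coefs gamma' a' p' q' b' r' s' ->
  (forall N, exists u v, [/\ u <= - N, v <= - N &
    hyp_form (gamma u) (gamma' v) <= K]) ->
  b * s' + s * b' - 2 * r * r' = 0.
Proof.
move=> g0 g0' [gU gP gQ [a0 b0 q0 s0] nA nC nAC].
move=> [gU' gP' gQ' [a0' b0' q0' s0'] nA' nC' nAC'] H.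
apply/eqP; rewrite eq_le; apply/andP; split; last exact: null_form_ge0.
apply: (@le0_exp _ `|K|) => t t0.
have [u [v [ut vt]]] := H t.
rewrite hyp_form_coefs// gP gQ gU gP' gQ' gU'.
have -> : (a * expR u + b * expR (- u)) * (q' * expR v + s' * expR (- v)) +
  (q * expR u + s * expR (- u)) * (a' * expR v + b' * expR (- v)) -
  2 * (p * expR u + r * expR (- u)) * (p' * expR v + r' * expR (- v)) =
  (a * q' + q * a' - 2 * p * p') * (expR u * expR v) +
  (a * s' + q * b' - 2 * p * r') * (expR u * expR (- v)) +
  (b * q' + s * a' - 2 * r * p') * (expR (- u) * expR v) +
  (b * s' + s * b' - 2 * r * r') * (expR (- u) * expR (- v)) by ring.
have h1 : 0 <= (a * q' + q * a' - 2 * p * p') * (expR u * expR v).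
  by rewrite mulr_ge0 ?null_form_ge0// mulr_ge0 ?expR_ge0.
have h2 : 0 <= (a * s' + q * b' - 2 * p * r') * (expR u * expR (- v)).
  by rewrite mulr_ge0 ?null_form_ge0// mulr_ge0 ?expR_ge0.
have h3 : 0 <= (b * q' + s * a' - 2 * r * p') * (expR (- u) * expR v).
  by rewrite mulr_ge0 ?null_form_ge0// mulr_ge0 ?expR_ge0.
have h4 : (b * s' + s * b' - 2 * r * r') * expR t <=
   (b * s' + s * b' - 2 * r * r') * (expR (- u) * expR (- v)).
  apply: ler_wpM2l; first exact: null_form_ge0.
  rewrite -expRD ler_expR; lra.
have := ler_norm K; lra.
Qed.

(** Orthogonal null vectors are proportional, so geodesics with orthogonal backward vectors share
    their backward end. The last hypothesis excludes the zero vector. *)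
Lemma null_proportional (b r s b' r' s' : R) : 0 < b -> 0 <= b' ->
  b * s = r ^+ 2 -> b' * s' = r' ^+ 2 ->
  b * s' + s * b' - 2 * r * r' = 0 -> r' ^+ 2 + s' ^+ 2 + b' ^+ 2 != 0 ->
  0 < b' /\ r' / b' = r / b.
Proof.
move=> b0 b0' E E' O nz.
have sE : s = r ^+ 2 / b by rewrite -E; field; lra.
have O' : b ^+ 2 * s' + r ^+ 2 * b' - 2 * r * r' * b = 0.
  by rewrite -[RHS](mul0r b) -O sE; field; lra.
have b'0 : 0 < b'.
  rewrite lt_def b0' andbT; apply: contra nz => /eqP b'0.
  have r'0 : r' = 0.
    by move/esym/eqP: E'; rewrite b'0 mul0r sqrf_eq0 => /eqP.
  move: O'; rewrite b'0 r'0 !(mulr0, mul0r, subr0, addr0) => /eqP.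
  by rewrite mulf_eq0 sqrf_eq0 (gt_eqF b0) /= => /eqP ->; rewrite expr0n /= !addr0.
split=> //; have : (b * r' - r * b') ^+ 2 = 0.
  have -> : (b * r' - r * b') ^+ 2 =
    b ^+ 2 * r' ^+ 2 + r ^+ 2 * b' * b' - 2 * r * r' * b * b' by ring.
  by rewrite -E' -[RHS](mul0r b') -O'; ring.
move/eqP; rewrite sqrf_eq0 => /eqP e0.
have -> : r' = r * b' / b.
  apply: (@mulIf _ b); first by rewrite gt_eqF.
  by rewrite divfK ?gt_eqF// mulrC; apply: subr0_eq.
by field; lra.
Qed.

Lemma geodesic_coefs_up gamma a p q b r s t :
  (forall t, 0 < (gamma t).2) -> geodesic_coefs gamma a p q b r s -> a = 0 ->
  gamma t = ((gamma 0).1, (gamma 0).2 * expR t).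
Proof.
move=> g0 [gU gP gQ _ nA nC nAC] a0.
have p0 : p = 0 by move/esym/eqP: nA; rewrite a0 mul0r sqrf_eq0 => /eqP.
have yE u : (gamma u).2 = b^-1 * expR u.
  by rewrite -[LHS]invrK gU a0 mul0r add0r invfM expRN invrK.
have xE u : (gamma u).1 = r / b.
  have -> : (gamma u).1 = (gamma u).1 / (gamma u).2 * (gamma u).2.
    by rewrite divfK// gt_eqF.
  have := g0 0; rewrite yE expR0 mulr1 invr_gt0 => b0; have et := expR_gt0 u.
  by rewrite gP yE p0 mul0r add0r expRN; field; lra.
by rewrite [LHS]surjective_pairing xE yE xE yE expR0 mulr1.
Qed.

Lemma geodesic_coefs_down gamma a p q b r s t :
  (forall t, 0 < (gamma t).2) -> geodesic_coefs gamma a p q b r s -> b = 0 ->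
  gamma t = ((gamma 0).1, (gamma 0).2 * expR (- t)).
Proof.
move=> g0 [gU gP gQ [a0 b0 q0 s0] nA nC nAC] b00.
have G : geodesic_coefs (fun t => gamma (- t)) b r s a p q.
  split=> //; last by lra.
  - by move=> u; rewrite gU opprK addrC.
  - by move=> u; rewrite gP opprK addrC.
  - by move=> u; rewrite gQ opprK addrC.
have := @geodesic_coefs_up _ _ _ _ _ _ _ (- t) (fun t => g0 (- t)) G b00.
by rewrite opprK oppr0.
Qed.

Lemma geodesic_coefs_height gamma a p q b r s t :
  (forall t, 0 < (gamma t).2) -> geodesic_coefs gamma a p q b r s -> 0 < a ->
  (gamma t).2 <= expR (- t) / a.
Proof.
move=> g0 [gU _ _ [_ b0 _ _] _ _ _] a0.
rewrite -[leLHS]invrK gU -[leRHS]invrK lef_pV2 ?posrE.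
- by rewrite invfM invrK -expRN opprK mulrC lerDl mulr_ge0// expR_ge0.
- by rewrite -gU invr_gt0.
- by rewrite invr_gt0 divr_gt0// expR_gt0.
Qed.

Lemma geodesic_coefs_back gamma a p q b r s :
  (forall t, 0 < (gamma t).2) -> geodesic_coefs gamma a p q b r s -> 0 < b ->
  (((gamma 0).1 - r / b) ^+ 2 + (gamma 0).2 ^+ 2) / (gamma 0).2 = b^-1.
Proof.
move=> g0 [gU gP gQ _ nA nC nAC] b0.
have -> : (((gamma 0).1 - r / b) ^+ 2 + (gamma 0).2 ^+ 2) / (gamma 0).2 =
  ((gamma 0).1 ^+ 2 + (gamma 0).2 ^+ 2) / (gamma 0).2 -
  2 * (r / b) * ((gamma 0).1 / (gamma 0).2) + (r / b) ^+ 2 * (gamma 0).2^-1.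
  by have := g0 0; move=> ?; field; lra.
rewrite gP gQ gU oppr0 expR0 !mulr1.
have sE : s = r ^+ 2 / b by rewrite -nC; field; lra.
have qE : q = (1 + 2 * p * r - a * s) / b.
  have -> : 1 + 2 * p * r - a * s = q * b by lra.
  by field; lra.
by rewrite qE sE; field; lra.
Qed.

(** [k] is the squared sine of half the angle at time [T] between the geodesic and the downward
    vertical, and the second equation is the law of cosines with two sides of length 1. It makes the
    angle readable from a leafwise distance, hence comparable across leaves. *)
Lemma geodesic_turn gamma a p q b r s T :
  (forall t, 0 < (gamma t).2) -> geodesic_coefs gamma a p q b r s ->
  let y := (gamma T).2 in
  let k := b * expR (- T) * y in
  a * expR T * y = 1 - k /\
  hyp_form (gamma (T + 1)) ((gamma T).1, y * expR (-1)) =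
    2 + (expR 1 - expR (-1)) ^+ 2 * k.
Proof.
move=> g0 [gU gP gQ _ nA nC nAC] y k.
have y0 : 0 < y := g0 T.
have yE : (a * expR T + b * expR (- T)) * y = 1 by rewrite -gU mulVf// gt_eqF.
have E1 : a * expR T * y = 1 - k by rewrite -yE /k; ring.
split=> //.
rewrite hyp_form_coefs//=; last by rewrite mulr_gt0// expR_gt0.
rewrite gP gQ gU opprD !expRD.
have e0 : 0 < expR 1 :> R := expR_gt0 1.
have -> : expR (-1) = (expR 1)^-1 :> R by rewrite expRN.
move: (expR 1) e0 => e e0.
have -> : ((gamma T).1 ^+ 2 + (y * e^-1) ^+ 2) / (y * e^-1) =
  e * (((gamma T).1 ^+ 2 + y ^+ 2) / y) - (e - e^-1) * y by field; lra.
have -> : (gamma T).1 / (y * e^-1) = e * ((gamma T).1 / y) by field; lra.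
have -> : (y * e^-1)^-1 = e * y^-1 by field; lra.
rewrite /y gP gQ gU -/y.
have ETT : expR T * expR (- T) = 1 :> R by rewrite -expRD subrr expR0.
rewrite /k in E1 *; move: (expR T) (expR (- T)) E1 ETT => u v E1 uv.
have -> : (a * (u * e) + b * (v * e^-1)) * (e * (q * u + s * v) - (e - e^-1) * y) +
  (q * (u * e) + s * (v * e^-1)) * (e * (a * u + b * v)) -
  2 * (p * (u * e) + r * (v * e^-1)) * (e * (p * u + r * v)) =
  2 * e ^+ 2 * u ^+ 2 * (a * q - p ^+ 2) + 2 * v ^+ 2 * (b * s - r ^+ 2)
  + (e ^+ 2 + 1) * (u * v) * (a * s + q * b - 2 * p * r)
  - (e - e^-1) * (e * (a * u * y) + e^-1 * (b * v * y)) by field; lra.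
rewrite nA nC nAC uv E1; field; lra.
Qed.

Lemma geodesic_towards z (c : R) : 0 < z.2 ->
  exists gamma : R -> R * R, [/\ forall t, 0 < (gamma t).2, gamma 0 = z,
    forall s t, hyp_form (gamma s) (gamma t) = dcosh (s - t) &
    exists a p q b r s, [/\ geodesic_coefs gamma a p q b r s, 0 < a & p / a = c]].
Proof.
case: z => x y /= y0.
(* [a] is dictated by the horocycle equation at time 0 for the end [c]. The forward null vector is
   [a] times [(1, c, c ^+ 2)]; the backward one is what remains of the hyperboloid coordinates of
   the base point. *)
pose a := y / ((x - c) ^+ 2 + y ^+ 2).
have n0 : 0 < (x - c) ^+ 2 + y ^+ 2 by rewrite ltr_wpDl ?sqr_ge0// exprn_gt0.
have a0 : 0 < a by rewrite divr_gt0.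
pose b := (x - c) ^+ 2 / (y * ((x - c) ^+ 2 + y ^+ 2)).
have b0 : 0 <= b by rewrite divr_ge0 ?sqr_ge0// mulr_ge0// ltW.
have abE : a + b = y^-1 by rewrite /a /b; field; lra.
pose p := a * c; pose q := a * c ^+ 2; pose r := x / y - p.
pose s := (x ^+ 2 + y ^+ 2) / y - q.
have nA : a * q = p ^+ 2 by rewrite /p /q; ring.
have nC : b * s = r ^+ 2 by rewrite /r /s /p /q /b /a; field; lra.
have nAC : a * s + q * b - 2 * p * r = 1.
  by rewrite /r /s /p /q /b /a; field; lra.
have q0 : 0 <= q by rewrite mulr_ge0 ?sqr_ge0// ltW.
have s0 : 0 <= s.
  have sE : s * a = (x * (x - c) + y ^+ 2) ^+ 2 / ((x - c) ^+ 2 + y ^+ 2) ^+ 2.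
    by rewrite /s /q /a; field; lra.
  by rewrite -(pmulr_lge0 _ a0) sE divr_ge0// sqr_ge0.
pose U t := a * expR t + b * expR (- t).
have U0 t : 0 < U t.
  apply: ltr_pwDl; [exact: mulr_gt0 a0 (expR_gt0 _)|].
  exact: mulr_ge0 b0 (expR_ge0 _).
pose gamma t := ((p * expR t + r * expR (- t)) / U t, (U t)^-1).
have g0 t : 0 < (gamma t).2 by rewrite invr_gt0.
have gc : geodesic_coefs gamma a p q b r s.
  split; [| | |by split=> //; exact: ltW| | |] => // t; rewrite /gamma /=.
  - by rewrite invrK.
  - by rewrite invrK divfK// gt_eqF.
  - have Ut := U0 t.
    have -> : (((p * expR t + r * expR (- t)) / U t) ^+ 2 + (U t)^-1 ^+ 2) / (U t)^-1 =
      ((p * expR t + r * expR (- t)) ^+ 2 + 1) / U t by field; lra.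
    have E : (q * expR t + s * expR (- t)) * U t =
        (p * expR t + r * expR (- t)) ^+ 2 + 1.
      have ETT : expR t * expR (- t) = 1 :> R by rewrite -expRD subrr expR0.
      rewrite /U; move: (expR t) (expR (- t)) ETT => u v uv.
      have -> : (q * u + s * v) * (a * u + b * v) = (a * q) * u ^+ 2 +
        (b * s) * v ^+ 2 + (a * s + q * b - 2 * p * r) * (u * v)
        + 2 * p * r * (u * v) by ring.
      have -> : (p * u + r * v) ^+ 2 = p ^+ 2 * u ^+ 2 + r ^+ 2 * v ^+ 2 +
        2 * p * r * (u * v) by ring.
      by rewrite nA nC nAC uv; ring.
    by rewrite -E mulfK// gt_eqF.
exists gamma; split=> //.
- rewrite /gamma /U oppr0 expR0 !mulr1 abE invrK; congr pair.
  by rewrite /r; field; lra.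
- move=> u v; rewrite hyp_form_coefs//.
  rewrite (gc_mid gc u) (gc_sqr gc u) (gc_inv gc u).
  rewrite (gc_mid gc v) (gc_sqr gc v) (gc_inv gc v).
  rewrite /dcosh opprB !expRD.
  have EU : expR u * expR (- u) = 1 :> R by rewrite -expRD subrr expR0.
  transitivity (2 * (a * q - p ^+ 2) * expR u * expR v +
    2 * (b * s - r ^+ 2) * expR (- u) * expR (- v) +
    (a * s + q * b - 2 * p * r) * (expR u * expR (- v) + expR v * expR (- u))).
    by ring.
  by rewrite nA nC nAC; ring.
- exists a, p, q, b, r, s; split=> //.
  by rewrite /p mulrC mulKf// gt_eqF.
Qed.

(** Hyperbolic discs are Euclidean discs, hence convex; a Euclidean segment from [z] can thus serve
    as a path that never goes farther from [z] than its end [w]. *)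
Lemma hyp_form_segment z w t : 0 < z.2 -> 0 < w.2 -> 0 <= t <= 1 ->
  let m := (z.1 + t * (w.1 - z.1), z.2 + t * (w.2 - z.2)) in
  0 < m.2 /\ hyp_form z m <= hyp_form z w.
Proof.
case: z w => [x y] [x' y'] /= y0 y0' /andP[t0 t1].
have m0 : 0 < y + t * (y' - y) by nra.
split=> //; rewrite /hyp_form /=.
rewrite ler_pdivlMr ?mulr_gt0// mulrAC ler_pdivrMr ?mulr_gt0//.
have -> : x - (x + t * (x' - x)) = t * (x - x') by ring.
rewrite -subr_ge0.
have -> : ((x - x') ^+ 2 + y ^+ 2 + y' ^+ 2) * (y * (y + t * (y' - y))) -
  ((t * (x - x')) ^+ 2 + y ^+ 2 + (y + t * (y' - y)) ^+ 2) * (y * y') =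
  y * (1 - t) * (y + t * y') * ((x - x') ^+ 2 + (y' - y) ^+ 2) by ring.
apply: mulr_ge0; last by rewrite addr_ge0// sqr_ge0.
by apply: mulr_ge0; [apply: mulr_ge0; lra | rewrite addr_ge0 ?mulr_ge0// ltW].
Qed.
End HalfPlane.

(** * Numerical bounds for a geodesic at a large time *)

Section Estimates.
Context {R : realType}.
Implicit Types x y e a b f u d k m : R.

(** In these bounds [f] and [u] stand for [expR (- T)] and [expR T], and [e] for the forward end. A
    horocycle of diameter [f / a] stays within [f / a] of its base point horizontally. *)
Lemma horizontal_estimate x y e a f d : 0 < a -> 0 < f -> 0 < y ->
  (x - e) ^+ 2 + y ^+ 2 = y * f / a -> f < d * a -> `|e - x| < d.
Proof.
move=> a0 f0 y0 circ fd.
have fa0 : 0 < f / a by exact: divr_gt0.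
have ya : y <= f / a.
  rewrite -(ler_pM2l y0) mulrA -circ -expr2 lerDr sqr_ge0//.
have : `|x - e| <= f / a.
  rewrite -ler_sqr ?nnegrE ?normr_ge0//; last exact: ltW.
  rewrite real_normK ?num_real//.
  have -> : (x - e) ^+ 2 = y * (f / a) - y ^+ 2 by rewrite mulrA -circ; ring.
  have := sqr_ge0 y; nra.
by rewrite distrC => /le_lt_trans; apply; rewrite ltr_pdivrMr.
Qed.

(** [y * u] is the height after flowing back for time [T]; it equals [(a + b * f ^+ 2)^-1], which
    tends to [a^-1]. *)
Lemma vertical_estimate y a b f u d : 0 < a -> 0 <= b -> 0 < f -> f <= 1 ->
  u * f = 1 -> 0 < y -> y^-1 = a * u + b * f -> f < d * a ^+ 2 / (b + 1) ->
  `|a^-1 - y * u| < d.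
Proof.
move=> a0 b0 f0 f1 uf y0 yE.
have b1 : 0 < b + 1 by lra.
rewrite ltr_pdivlMr// => fd.
have c0 : 0 < a + b * f ^+ 2 by rewrite ltr_pwDl// mulr_ge0// sqr_ge0.
have yuE : y * u = (a + b * f ^+ 2)^-1.
  apply: (@mulIf _ (a + b * f ^+ 2)); first by rewrite gt_eqF.
  rewrite mulVf ?gt_eqF//.
  have -> : y * u * (a + b * f ^+ 2) = y * (a * u + b * f * (u * f)) by ring.
  by rewrite uf mulr1 -yE mulfV// gt_eqF.
have -> : a^-1 - y * u = b * f ^+ 2 / (a * (a + b * f ^+ 2)).
  by rewrite yuE; field; lra.
rewrite ger0_norm; last by rewrite divr_ge0// ?mulr_ge0 ?sqr_ge0// ltW// ltr_wpDr.
rewrite ltr_pdivrMr ?mulr_gt0//.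
have d0 : 0 < d * a ^+ 2 by apply: lt_trans fd; exact: mulr_gt0.
have dpos : 0 < d by move: d0; rewrite pmulr_lgt0// exprn_gt0.
have h1 : b * f ^+ 2 <= f * (b + 1).
  have : b * f ^+ 2 <= b * f by rewrite ler_wpM2l// expr2 ler_piMr// ltW.
  lra.
have h2 : 0 <= d * a * (b * f ^+ 2) by rewrite !mulr_ge0// ?sqr_ge0// ltW.
lra.
Qed.

Lemma angle_estimate y a b f k : 0 < a -> 0 <= b -> 0 < f -> f <= 1 ->
  y <= f / a -> f < k * a / (b + 1) -> b * f * y < k.
Proof.
move=> a0 b0 f0 f1 ya; have b1 : 0 < b + 1 by lra.
rewrite ltr_pdivlMr// => fk.
have h : b * f * y <= b * f * (f / a) by rewrite ler_wpM2l// mulr_ge0// ltW.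
apply: le_lt_trans h _; rewrite mulrA ltr_pdivrMr//; apply: le_lt_trans fk.
have : b * f * f <= b * f by rewrite ler_piMr// mulr_ge0// ltW.
lra.
Qed.

(** The point at time [T] and the point at the same height over the end are both flowed back by [T].
    Their form exceeds 2 by [k / (1 - k) / u ^+ 2], so only [k] has to be small: the bound is
    uniform in [a] and [u], hence in the leaf. *)
Lemma same_height_estimate x y e a f u k m : 0 < a -> 0 < y -> 1 <= u -> u * f = 1 ->
  a * u * y = 1 - k -> (x - e) ^+ 2 + y ^+ 2 = y * f / a -> 0 <= k ->
  0 < m -> k < m / (1 + m) -> hyp_form (x, y * u) (e, y * u) < 2 + m.
Proof.
move=> a0 y0 u1 uf ak circ k0 m0 km.
have k1 : 0 < 1 - k by rewrite -ak !mulr_gt0//; lra.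
have Y0 : 0 < y * u by rewrite mulr_gt0//; lra.
have u0 : 0 < u by lra.
have xe : (x - e) ^+ 2 = y ^+ 2 * (k / (1 - k)).
  have -> : (x - e) ^+ 2 = y * f / a - y ^+ 2 by rewrite -circ; ring.
  have fE : f = u^-1 by apply: (mulfI (lt0r_neq0 u0)); rewrite uf mulfV ?gt_eqF.
  have aE : a = (1 - k) / (u * y) by rewrite -ak; field; lra.
  by rewrite aE fE; field; lra.
have -> : hyp_form (x, y * u) (e, y * u) = 2 + (x - e) ^+ 2 / (y * u) ^+ 2.
  by rewrite /hyp_form /=; field; lra.
rewrite ltrD2l xe.
have -> : y ^+ 2 * (k / (1 - k)) / (y * u) ^+ 2 = k / (1 - k) / u ^+ 2.
  by field; lra.
have kk : 0 <= k / (1 - k) by rewrite divr_ge0// ltW.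
apply: (@le_lt_trans _ _ (k / (1 - k))).
  rewrite ler_pdivrMr ?exprn_gt0// ler_peMr//; nra.
rewrite ltr_pdivrMr//; move: km; rewrite ltr_pdivlMr; last by lra.
lra.
Qed.
End Estimates.

(** * Plaques of a leaf *)

Section RealLine.
Context {R : realType}.

Lemma locally_constant_line (Q : R -> Prop) :
  (forall t, \forall s \near t, Q s <-> Q t) -> forall s t, Q s -> Q t.
Proof.
move=> lQ s t Qs.
have oQ : open [set t | Q t].
  rewrite openE => u Qu; apply: filterS (lQ u) => v [_ H]; exact: H.
have cQ : closed [set t | Q t].
  rewrite -openC openE => u Qu; apply: filterS (lQ u) => v [H _] /H; exact: Qu.
have cR : connected [set: R] by apply/connected_intervalP.
suff QT : [set t | Q t] = setT by have : [set: R] t by []; rewrite -QT.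
apply: cR; first by exists s.
- by exists [set t | Q t] => //; rewrite setTI.
- by exists [set t | Q t] => //; rewrite setTI.
Qed.

(** Otherwise the image contains an interval by the intermediate value theorem, and an interval has
    positive measure while a countable set has measure zero. *)
Lemma countable_image_const (h : R -> R) a b : a <= b ->
  {within `[a, b], continuous h} -> countable (h @` `[a, b]) -> h a = h b.
Proof.
move=> ab ch cnt; apply: contrapT => hab.
pose l := Num.min (h a) (h b); pose u := Num.max (h a) (h b).
have lu : l < u.
  by rewrite /l /u; case: (ltgtP (h a) (h b)) => // hE; case: hab.
have sub : `[l, u]%classic `<=` h @` `[a, b].
  move=> v /=; rewrite in_itv /= => lvu.
  have [c cab <-] := IVT ab ch lvu; by exists c.
have := countable_lebesgue_measure0 (sub_countable (subset_card_le sub) cnt).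
rewrite lebesgue_measure_itv /= lte_fin lu -EFinB => -[] /eqP.
by rewrite subr_eq0 gt_eqF.
Qed.

Lemma rat_near (v : R) e : 0 < e -> exists a : rat, `|v - ratr a| < e.
Proof.
move=> e0; have : v - e < v + e by lra.
move=> /rat_in_itvoo[a]; rewrite in_itv /= => /andP[a1 a2]; exists a.
by rewrite distrC ltr_distl a1 a2.
Qed.
End RealLine.

Section Charts.
Context {R : realType} {M : topologicalType} {n : nat}.
Implicit Types (c : @chart R M n).

Lemma chart_nbhs c x : cdom c x -> nbhs x (cdom c).
Proof. by move=> cx; apply: open_nbhs_nbhs; split=> //; exact: cdom_open. Qed.

Lemma chart_continuous c x : cdom c x -> {for x, continuous c}.
Proof.
move=> cx; have := @cmap_cont _ _ _ c.
rewrite (continuous_open_subspace _ (cdom_open c)); apply; exact: mem_set.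
Qed.

Lemma cinv_dom c v : cdom c (cinv c v).
Proof. by have [] := cinvK c v. Qed.

Lemma cinvE c v : c (cinv c v) = v.
Proof. by have [] := cinvK c v. Qed.
End Charts.

Section Plaques.
Context {R : realType} {M : topologicalType} (F : @foliation R M).
Implicit Types (c e : @chart R M (2 + 1)).

Lemma plaque_nbhs c e x : fatlas F c -> fatlas F e -> cdom c x -> cdom e x ->
  exists N : set M, [/\ nbhs x N, N `<=` cdom c `&` cdom e & forall p q, N p -> N q ->
    trans_coord (c p) = trans_coord (c q) <-> trans_coord (e p) = trans_coord (e q)].
Proof.
move=> Fc Fe cx ex; have [N [oN Nx sub H]] := fatlas_compat Fc Fe cx ex.
by exists N; split=> //; exact: open_nbhs_nbhs.
Qed.

Definition rat_point (a b : rat) (t : R) : 'rV[R]_(2 + 1) :=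
  \row_i nth 0 [:: ratr a; ratr b; t] i.

Lemma trans_rat_point a b t : trans_coord (rat_point a b t) = t.
Proof. by rewrite /trans_coord mxE. Qed.

(* Rational points are dense in every plaque, so the plaques of [e] met by a
   given plaque of [c] are indexed by pairs of rationals. *)
Lemma plaque_rat_point c e x : fatlas F c -> fatlas F e ->
  cdom c x -> cdom e x -> exists a b : rat, trans_coord (e x) =
    trans_coord (e (cinv c (rat_point a b (trans_coord (c x))))).
Proof.
move=> Fc Fe cx ex; have [N [Nx sub H]] := plaque_nbhs Fc Fe cx ex.
have : nbhs (c x) (cinv c @^-1` N).
  by apply: (@cinv_cont _ _ _ c); rewrite cmapK.
move=> /nbhs_ballP[d /= d0 dN].
have [a ax] := rat_near ((c x) 0 ord0) d0.
have [b bx] := rat_near ((c x) 0 (inord 1)) d0.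
exists a, b; have /dN /= Nq : ball (c x) d (rat_point a b (trans_coord (c x))).
  split=> // i j; rewrite [i]ord1 mxE /ball /=.
  have [-> /=|j0] := eqVneq j ord0; first exact: ax.
  have [-> /=|j1] := eqVneq j (inord 1); first by rewrite inordK.
  have -> : j = ord_max.
    apply/val_inj => /=; have := ltn_ord j; move: j0 j1.
    rewrite -!(inj_eq val_inj) /= inordK//; by case: (val j) => [|[|[|]]].
  by rewrite /= subrr normr0.
apply/(H _ _ (nbhs_singleton Nx) Nq).
by rewrite cinvE trans_rat_point.
Qed.

(* A pair [(i, t)] stands for the plaque at level [t] of the chart [cs i]. *)
Definition plaque_step (cs : nat -> @chart R M (2 + 1)) (st : nat * R)
    (k : nat * (rat * rat)) : nat * R :=
  (k.1, trans_coord (cs k.1 (cinv (cs st.1) (rat_point k.2.1 k.2.2 st.2)))).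

(** A finite word of moves, each a next chart and two rational plaque coordinates, encodes a chain
    of plaques; there are only countably many words. *)
Definition reachable (cs : nat -> @chart R M (2 + 1)) (st : nat * R) : set (nat * R) :=
  range (foldl (plaque_step cs) st).

Lemma countable_reachable cs st : countable (reachable cs st).
Proof. exact: sub_countable (card_image_le _ _) (countableP _). Qed.

Lemma reachable_step cs st i j x : (forall i, fatlas F (cs i)) ->
  cdom (cs i) x -> cdom (cs j) x -> reachable cs st (i, trans_coord (cs i x)) ->
  reachable cs st (j, trans_coord (cs j x)).
Proof.
move=> Fcs ix jx [l _ lE].
have [a [b ->]] := plaque_rat_point (Fcs i) (Fcs j) ix jx.
by exists (rcons l (j, (a, b))) => //; rewrite foldl_rcons lE.
Qed.

(** A plaque chain in the leaf may use charts [c] outside the countable family. The segment [g]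
    joins two consecutive points inside a plaque of [c], and reachability of the plaques of the
    family met along it is locally constant. *)
Lemma leaf_reachable cs i m x : (forall i, fatlas F (cs i)) ->
  (forall y, exists i, cdom (cs i) y) -> cdom (cs i) m -> leaf F m x ->
  forall j, cdom (cs j) x ->
    reachable cs (i, trans_coord (cs i m)) (j, trans_coord (cs j x)).
Proof.
move=> Fcs cov im; elim.
  by move=> j jm; apply: reachable_step im jm _ => //; exists [::].
move=> y z _ IH [c [Fc cy cz yz]].
pose g := cinv c \o (fun t : R => c y + t *: (c z - c y)).
pose Q t := forall j, cdom (cs j) (g t) ->
  reachable cs (i, trans_coord (cs i m)) (j, trans_coord (cs j (g t))).
have gc : continuous g.
  move=> t; apply: continuous_comp; last exact: cinv_cont.
  by apply: cvgD; [exact: cvg_cst|apply: cvgZr_tmp; exact: cvg_id].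
have gtr t : trans_coord (c (g t)) = trans_coord (c y).
  rewrite /g /= cinvE /trans_coord !mxE.
  by move: yz; rewrite /trans_coord => ->; rewrite subrr mulr0 addr0.
have Q01 : Q 0 -> Q 1.
  apply: locally_constant_line => t.
  have [j jt] := cov (g t).
  have [N [Nt sub NH]] := plaque_nbhs Fc (Fcs j) (cinv_dom c _) jt.
  have gN : nbhs t (g @^-1` N) by exact: gc.
  apply: filterS gN => s Ns.
  have js : cdom (cs j) (g s) by have [] := sub _ Ns.
  have E : trans_coord (cs j (g s)) = trans_coord (cs j (g t)).
    by apply/(NH _ _ Ns (nbhs_singleton Nt)); rewrite !gtr.
  split=> Qs k kx; apply: (reachable_step (i := j)) kx _ => //.
  - by rewrite -E; exact: Qs.
  - by rewrite E; exact: Qs.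
have g0 : g 0 = y by rewrite /g /= scale0r addr0 cmapK.
have g1 : g 1 = z by rewrite /g /= scale1r addrC subrK cmapK.
by move: Q01; rewrite /Q g0 g1; apply.
Qed.

Lemma finite_foliated_cover : compact [set: M] -> exists l : seq M,
  forall x : M, exists2 y, y \in l & cdom (sval (cid2 (fatlas_cover F y))) x.
Proof.
move=> /compact_near_coveringP cM.
(* Along [G] a sequence eventually contains any prescribed finite list, so the near-covering form of
   compactness yields one sequence that serves all points. *)
pose G := filter_from [set: seq M] (fun l0 => [set l : seq M | {subset l0 <= l}]).
have FG : Filter G.
  apply: filter_fromT_filter; first by exists [::].
  by move=> i j; exists (i ++ j) => l /= il; split=> x xi; apply: il;
    rewrite mem_cat xi ?orbT.
have [|l _ H] := cM _ G (fun (l : seq M) x =>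
  exists2 y, y \in l & cdom (sval (cid2 (fatlas_cover F y))) x).
- move=> x _; exists (cdom (sval (cid2 (fatlas_cover F x))), [set l : seq M | {subset [:: x] <= l}]).
    split; last by exists [:: x].
    by apply: chart_nbhs; case: cid2.
  by move=> [x' l] /= [xx' xl]; exists x => //; apply: xl; rewrite mem_head.
by exists l => x; apply: (H l) => //.
Qed.

Lemma countable_leaf_trans c m : compact [set: M] -> fatlas F c ->
  countable [set trans_coord (c x) | x in leaf F m `&` cdom c].
Proof.
move=> cM Fc; have [l cov] := finite_foliated_cover cM.
(* [c] has index 0, so that its transverse coordinates appear in the reachable states; it is also
   the default beyond the finite list, so that every index gives a foliated chart. *)
pose cs := nth c (c :: [seq sval (cid2 (fatlas_cover F y)) | y <- l]).
have Fcs i : fatlas F (cs i).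
  rewrite /cs; case: i => //= i; have [il|il] := ltnP i (size l).
    by rewrite (nth_map m)//; case: cid2.
  by rewrite nth_default// size_map.
have covs y : exists i, cdom (cs i) y.
  have [z zl zy] := cov y; exists (index z l).+1.
  by rewrite /cs /= (nth_map m) ?index_mem// nth_index.
have [i im] := covs m.
apply: sub_countable (countable_reachable cs (i, trans_coord (cs i m))).
apply: card_le_trans (card_image_le snd _); apply: subset_card_le.
move=> _ [x [mx cx] <-].
exists (0%N, trans_coord (c x)) => //.
exact: (leaf_reachable Fcs covs im mx (j := 0%N)).
Qed.

(** The path is continuous only for the topology of [M], and a leaf may cross the chart infinitely
    often. But the transverse coordinate takes countably many values on the leaf, so along the path
    it is locally constant. *)
Lemma leaf_path_trans (f : R -> M) c m t : compact [set: M] -> fatlas F c ->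
  continuous f -> (forall u, leaf F m (f u)) -> cdom c (f t) ->
  \forall s \near t, cdom c (f s) /\ trans_coord (c (f s)) = trans_coord (c (f t)).
Proof.
move=> cM Fc cf mf ct.
have /nbhs_ballP[d /= d0 dc] : nbhs t (f @^-1` cdom c) by exact/cf/chart_nbhs.
pose h u := trans_coord (c (f u)).
have key a b : a <= b -> ball t d a -> ball t d b -> h a = h b.
  move=> ab ta tb.
  have abd u : u \in `[a, b] -> cdom c (f u).
    rewrite in_itv /= => /andP[au ub]; apply: dc.
    move: ta tb; rewrite /ball /= !ltr_distl => /andP[? ?] /andP[? ?].
    by apply/andP; split; lra.
  apply: countable_image_const => //.
    apply: continuous_in_subspaceT => u; rewrite inE => /abd cu.
    apply: (@continuous_comp _ _ _ (c \o f) (fun v => trans_coord v)).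
      by apply: continuous_comp; [exact: cf | exact: chart_continuous].
    exact: coord_continuous.
  apply: sub_countable (countable_leaf_trans m cM Fc); apply: subset_card_le.
  by move=> _ [u uab <-]; exists (f u) => //; split=> //; exact: abd.
apply/nbhs_ballP; exists d => //= s ts; split; first exact: dc.
have tt : ball t d t by exact: ballxx.
by have [st|/ltW st] := leP s t; [|apply/esym]; apply: key.
Qed.

End Plaques.

(** * Foliated boxes in a covering *)

Lemma continuous_pair (S T U : topologicalType) (f : S -> T) (g : S -> U) x :
  {for x, continuous f} -> {for x, continuous g} ->
  {for x, continuous (fun y => (f y, g y))}.
Proof.
move=> cf cg A [[P Q] [/= nP nQ] sub].
have nf : nbhs x (f @^-1` P) by exact: cf.
have ng : nbhs x (g @^-1` Q) by exact: cg.
by apply: filterS2 nf ng => y Py Qy; exact: sub.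
Qed.

Section Clamp.
Context {R : realType}.

(* The retraction of the line onto [0, 1]. *)
Definition clamp (t : R) : R := (1 + `|t| - `|t - 1|) / 2.

Lemma clamp_itv t : 0 <= clamp t <= 1.
Proof.
rewrite /clamp; case: (ger0P t) => t0; case: (ger0P (t - 1)) => t1; lra.
Qed.

Lemma clamp_id t : 0 <= t <= 1 -> clamp t = t.
Proof.
by case/andP=> t0 t1; rewrite /clamp ger0_norm// ler0_norm; lra.
Qed.

Lemma clamp_continuous : continuous clamp.
Proof.
move=> t; apply: cvgM; last exact: cvg_cst.
apply: cvgB; first (apply: cvgD; first exact: cvg_cst).
  exact: norm_continuous.
by apply: cvg_norm; apply: cvgB; [exact: cvg_id | exact: cvg_cst].
Qed.

(** [joined] asks for continuity on the whole line; [clamp] extends a path known only on the unit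
    interval. *)
Lemma joined_line (T : topologicalType) (A : set T) (g : R -> T) :
  (forall t, 0 <= t <= 1 -> {for t, continuous g}) ->
  (forall t, 0 <= t <= 1 -> A (g t)) -> joined R A (g 0) (g 1).
Proof.
move=> cg Ag; exists (g \o clamp); split=> /=.
- move=> t; apply: continuous_comp; first exact: clamp_continuous.
  by apply: cg; exact: clamp_itv.
- by rewrite clamp_id// lexx ler01.
- by rewrite clamp_id// lexx ler01.
- by move=> t _; apply: Ag; exact: clamp_itv.
Qed.
End Clamp.

Section Coverings.
Context {X M : topologicalType} (pi : X -> M).
Hypothesis cov : covering pi.

Lemma covering_continuous : continuous pi.
Proof. by case: cov. Qed.

Lemma covering_sheet x : exists A : set X, exists U : set M, exists sg : M -> X,
  [/\ open A, A x, open U, U (pi x) & [/\ forall y, A y -> U (pi y) /\ sg (pi y) = y,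
    forall m, U m -> A (sg m) /\ pi (sg m) = m &
    forall m, U m -> {for m, continuous sg}]].
Proof.
have [cpi _ /(_ (pi x))[U [oU Ux [V [VU Vdisj VA]]]]] := cov.
have : (pi @^-1` U) x by [].
rewrite -VU => -[A VAA Ax]; have [oA [sg [H1 H2 _ H3]]] := VA _ VAA.
exists A, U, sg; split=> //; split=> // m Um.
by move: H3; rewrite (continuous_open_subspace _ oU); apply; exact: mem_set.
Qed.

Lemma covering_separated x y : hausdorff_space M -> x <> y ->
  exists A B : set X, [/\ open A, open B, A x, B y & A `&` B = set0].
Proof.
move=> hM xy; have [cpi _ /(_ (pi x))[U [oU Ux [V [VU Vdisj VA]]]]] := cov.
have [pxy|/eqP pxy] := pselect (pi x = pi y); last first.
  move: hM; rewrite open_hausdorff => /(_ _ _ pxy)[[A B] /= [xA yB] [oA oB AB0]].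
  rewrite inE in xA; rewrite inE in yB.
  exists (pi @^-1` A), (pi @^-1` B); split=> //.
  - by apply: open_comp => // ? _; exact: cpi.
  - by apply: open_comp => // ? _; exact: cpi.
  - by rewrite -preimage_setI (eqP AB0) preimage_set0.
have : (pi @^-1` U) x by [].
have : (pi @^-1` U) y by rewrite /= -pxy.
rewrite -VU => -[B VB By] [A VAA Ax].
have [oA [sg [H1 _ _ _]]] := VA _ VAA; have [oB _] := VA _ VB.
exists A, B; split=> //; apply: contrapT => /eqP/set0P AB.
apply: xy; have AB' := Vdisj _ _ VAA VB AB; rewrite -AB' in By.
by rewrite -(H1 _ Ax).2 -(H1 _ By).2 pxy.
Qed.

Lemma covering_hausdorff : hausdorff_space M -> hausdorff_space X.
Proof.
move=> hM; rewrite open_hausdorff => x y /eqP xy.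
have [A [B [oA oB Ax By AB]]] := covering_separated hM xy.
by exists (A, B) => /=; split=> //; rewrite ?inE//; exact/eqP.
Qed.

Lemma covering_lift_unique (R : realType) (f g : R -> X) : continuous f -> continuous g ->
  (forall t, pi (f t) = pi (g t)) -> f 0 = g 0 -> forall t, f t = g t.
Proof.
move=> cf cg fg f0 t; apply: (locally_constant_line (Q := fun t => f t = g t)) f0 => {}t.
have [cpi _ /(_ (pi (f t)))[U [oU Ux [V [VU Vdisj VA]]]]] := cov.
have : (pi @^-1` U) (f t) by [].
have : (pi @^-1` U) (g t) by rewrite /= -fg.
rewrite -VU => -[B VB Bg] [A VAA Af].
have [oA [sg [H1 _ _ _]]] := VA _ VAA; have [oB _] := VA _ VB.
have nA : nbhs t (f @^-1` A) by apply: cf; exact: open_nbhs_nbhs.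
have nB : nbhs t (g @^-1` B) by apply: cg; exact: open_nbhs_nbhs.
apply: filterS2 nA nB => s /= As Bs.
have eqA u : A (f u) -> A (g u) -> f u = g u.
  by move=> /H1[_ <-] /H1[_ <-]; rewrite fg.
split=> E.
  have AB : A = B by apply: Vdisj => //; exists (f s); split=> //; rewrite E.
  by apply: eqA => //; rewrite AB.
have AB : A = B by apply: Vdisj => //; exists (f t); split=> //; rewrite E.
by apply: eqA => //; rewrite AB.
Qed.
End Coverings.

Section Boxes.
Context {R : realType} {X M : topologicalType} (pi : X -> M) (F : @foliation R M).
Hypothesis cov : covering pi.

(* [k] lifts the inverse of the chart [c] over the ball of radius [r]. *)
Record box (x : X) (c : @chart R M (2 + 1)) (O : set X) (r : R)
    (k : 'rV[R]_(2 + 1) -> X) : Prop := {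
  box_gt0 : 0 < r;
  box_dom : cdom c (pi x);
  box_atlas : fatlas F c;
  box_center : k (c (pi x)) = x;
  box_pi : forall v, ball (c (pi x)) r v -> pi (k v) = cinv c v;
  box_sub : forall v, ball (c (pi x)) r v -> O (k v);
  box_cont : forall v, ball (c (pi x)) r v -> {for v, continuous k};
  box_near : forall v, ball (c (pi x)) r v ->
    \forall y \near k v, cdom c (pi y) /\ k (c (pi y)) = y }.

Lemma exists_box x O : nbhs x O -> exists c r k, box x c O r k.
Proof.
move=> Ox; have [c Fc cx] := fatlas_cover F (pi x).
have [A [U [sg [oA Ax oU Ux [H1 H2 H3]]]]] := covering_sheet cov x.
pose k := sg \o cinv c.
have kx : k (c (pi x)) = x by rewrite /k /= cmapK//; have [] := H1 _ Ax.
have kc v : U (cinv c v) -> {for v, continuous k}.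
  by move=> Uv; apply: continuous_comp; [exact: cinv_cont | exact: H3].
have nU : nbhs (c (pi x)) (cinv c @^-1` U).
  by apply: cinv_cont; rewrite cmapK//; exact: open_nbhs_nbhs.
have nO : nbhs (c (pi x)) (k @^-1` O).
  by apply: kc; rewrite ?cmapK// kx.
have /nbhs_ballP[r /= r0 rB] :
    nbhs (c (pi x)) ((cinv c @^-1` U) `&` (k @^-1` O)) by exact: filterI.
exists c, r, k; split=> //.
- by move=> v /rB[/= Uv _]; have [] := H2 _ Uv.
- by move=> v /rB[].
- by move=> v /rB[/= Uv _]; exact: kc.
- move=> v /rB[/= Uv _]; have [Av piv] := H2 _ Uv.
  have nA : nbhs (k v) A by apply: open_nbhs_nbhs.
  have nc : nbhs (k v) (pi @^-1` cdom c).
    apply: (covering_continuous cov); apply: chart_nbhs; rewrite [pi _]piv.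
    exact: cinv_dom.
  apply: filterS2 nA nc => y Ay cy; split=> //.
  by rewrite /k /= cmapK//; have [] := H1 _ Ay.
Qed.

Section BoxTheory.
Context (x : X) (c : @chart R M (2 + 1)) (O : set X) (r : R) (k : 'rV[R]_(2 + 1) -> X).
Hypothesis bx : box x c O r k.
Let v0 := c (pi x).

Lemma boxE v : ball v0 r v -> c (pi (k v)) = v.
Proof. by move=> Bv; rewrite (box_pi bx Bv) cinvE. Qed.

Lemma box_dom_pi v : ball v0 r v -> cdom c (pi (k v)).
Proof. by move=> Bv; rewrite (box_pi bx Bv); exact: cinv_dom. Qed.

Lemma box_coord_continuous v : ball v0 r v -> {for k v, continuous (c \o pi)}.
Proof.
move=> Bv; apply: continuous_comp; first exact: (covering_continuous cov).
apply: chart_continuous; exact: box_dom_pi.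
Qed.

Lemma box_leaf v w : ball v0 r v -> ball v0 r w -> trans_coord v = trans_coord w ->
  lifted_leaf pi F (k v) (k w).
Proof.
move=> Bv Bw vw; pose g (t : R) := v + t *: (w - v).
have Bg t : 0 <= t <= 1 -> ball v0 r (g t).
  move=> /andP[t0 t1]; move: Bv Bw; rewrite -ball_normE /= => Bv Bw.
  have -> : v0 - g t = (1 - t) *: (v0 - v) + t *: (v0 - w).
    by rewrite /g; apply/rowP => i; rewrite !mxE; ring.
  apply: le_lt_trans (ler_normD _ _) _; rewrite !normrZ !ger0_norm ?subr_ge0//.
  have [->|tn0] := eqVneq t 0; first by rewrite subr0 mul1r mul0r addr0.
  have : 0 < t by rewrite lt_def tn0.
  by nra.
have -> : k v = (k \o g) 0 by rewrite /= /g scale0r addr0.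
have -> : k w = (k \o g) 1 by rewrite /= /g scale1r addrC subrK.
apply: joined_line => t t01.
  apply: continuous_comp; last exact: (box_cont bx (Bg _ t01)).
  by apply: cvgD; [exact: cvg_cst|apply: cvgZr_tmp; exact: cvg_id].
rewrite /= (box_pi bx (Bg _ t01)).
apply: (same_leaf_step (same_leaf_refl _ _)).
have B0 : ball v0 r (g 0) by apply: Bg; rewrite lexx ler01.
exists c; split; [exact: box_atlas bx| exact: box_dom_pi | exact: cinv_dom |].
rewrite boxE// cinvE /g scale0r addr0 /trans_coord !mxE.
by move: vw; rewrite /trans_coord => ->; rewrite subrr mulr0 addr0.
Qed.

Lemma box_inj v w : ball v0 r v -> ball v0 r w -> k v = k w -> v = w.
Proof. by move=> Bv Bw E; rewrite -(boxE Bv) E boxE. Qed.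
End BoxTheory.
End Boxes.

(** * Leafwise balls *)

Section LeafMetric.
Context {R : realType} {X M : topologicalType} (pi : X -> M) (F : @foliation R M).
Context (D : leaf_metric pi F).

Lemma open_upper_half_plane : open (@upper_half_plane R).
Proof.
rewrite /upper_half_plane; apply: (@open_comp _ _ snd [set t : R | 0 < t]).
  by move=> ? _; exact: cvg_snd.
exact: open_gt.
Qed.

Section Isometry.
Context (x : X) (h : R * R -> X) (hi : leaf_isometry D x h).
Implicit Types z w : R * R.

Lemma isometry_continuous z : 0 < z.2 -> {for z, continuous h}.
Proof.
move=> z0; have [] := hi.
rewrite (continuous_open_subspace _ open_upper_half_plane) => H _ _.
by apply: H; exact: mem_set.
Qed.

Lemma isometry_in z : 0 < z.2 -> lifted_leaf pi F x (h z).
Proof. by move=> z0; have [_ <- _] := hi; exists z. Qed.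

Lemma isometry_leaf z w : 0 < z.2 -> 0 < w.2 -> lifted_leaf pi F (h z) (h w).
Proof.
move=> z0 w0; apply: lifted_leaf_trans (isometry_in w0).
exact/lifted_leaf_sym/isometry_in.
Qed.

Lemma isometry_surj y : lifted_leaf pi F x y -> exists2 z, 0 < z.2 & h z = y.
Proof. by have [_ <- _] := hi. Qed.

Lemma isometry_dist z w : 0 < z.2 -> 0 < w.2 -> D (h z) (h w) = hyp_dist z w.
Proof. by move=> z0 w0; have [_ _] := hi; apply. Qed.

Lemma isometry_dcosh z w : 0 < z.2 -> 0 < w.2 ->
  dcosh (D (h z) (h w)) = hyp_form z w.
Proof. by move=> z0 w0; rewrite isometry_dist//; have [_] := hyp_distP z0 w0. Qed.

Lemma isometry_le z w e : 0 < z.2 -> 0 < w.2 -> 0 <= e ->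
  (D (h z) (h w) <= e) = (hyp_form z w <= dcosh e).
Proof.
move=> z0 w0 e0; rewrite -isometry_dcosh// ler_dcosh//.
by apply: ldist_ge0; exact: isometry_leaf.
Qed.

Lemma isometry_lt z w e : 0 < z.2 -> 0 < w.2 -> 0 <= e ->
  (D (h z) (h w) < e) = (hyp_form z w < dcosh e).
Proof.
move=> z0 w0 e0; rewrite -isometry_dcosh// ltr_dcosh//.
by apply: ldist_ge0; exact: isometry_leaf.
Qed.
End Isometry.

Hypothesis cD : {within [set p : X * X | lifted_leaf pi F p.1 p.2],
  continuous (fun p => D p.1 p.2)}.

Lemma leaf_metric_near x y (e : R) : lifted_leaf pi F x y -> 0 < e ->
  \forall p \near (x, y), lifted_leaf pi F p.1 p.2 -> `|D x y - D p.1 p.2| < e.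
Proof.
move=> xy e0; move/subspace_continuousP: cD => /(_ (x, y) xy).
by move/cvgrPdist_lt => /(_ _ e0).
Qed.

Hypothesis iD : forall x, exists h, leaf_isometry D x h.
Hypothesis cov : covering pi.
Hypothesis cM : compact [set: M].
Hypothesis hM : hausdorff_space M.

Lemma leaf_segment y z : lifted_leaf pi F y z -> exists g : R -> X,
  [/\ continuous g, g 0 = y, g 1 = z,
      forall t, lifted_leaf pi F y (g t) & forall t, D y (g t) <= D y z].
Proof.
move=> yz; have [h hi] := iD y.
have [zy zy0 hy] := isometry_surj hi (lifted_leaf_refl pi F y).
have [zz zz0 hz] := isometry_surj hi yz.
pose m t := (zy.1 + clamp t * (zz.1 - zy.1), zy.2 + clamp t * (zz.2 - zy.2)).
have mP t : 0 < (m t).2 /\ hyp_form zy (m t) <= hyp_form zy zz.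
  exact: hyp_form_segment (clamp_itv t).
exists (h \o m); split=> /=.
- move=> t; apply: continuous_comp; last by apply: (isometry_continuous hi); case: (mP t).
  have cl a b : {for t, continuous (fun t : R => a + clamp t * b)}.
    apply: cvgD; first exact: cvg_cst.
    by apply: cvgM; [exact: clamp_continuous | exact: cvg_cst].
  by apply: continuous_pair; exact: cl.
- by rewrite /m clamp_id ?lexx ?ler01// !mul0r !addr0 -surjective_pairing.
- rewrite /m clamp_id ?lexx ?ler01// !mul1r ![_ + (_ - _)]addrC !subrK.
  by rewrite -surjective_pairing.
- by move=> t; apply: (isometry_in hi); case: (mP t).
- move=> t; have [m0 mz] := mP t.
  rewrite -hz -{1 2}hy (isometry_le hi)//; last first.
    by apply: (ldist_ge0 D); exact: (isometry_leaf hi).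
  by rewrite (isometry_dcosh hi).
Qed.

(* Leafwise balls of a uniform radius around the points near [x] are small in
   the topology of [X]: a leafwise path leaving a box stays in its plaque, hence
   crosses the frontier of the box, at a leafwise distance bounded below by
   compactness. *)
Lemma leaf_ball_near (x : X) (O : set X) : nbhs x O -> exists2 eta : R, 0 < eta &
  \forall y \near x, forall z, lifted_leaf pi F y z -> D y z < eta -> O z.
Proof.
move=> /(exists_box F cov)[c [r [k bx]]]; have r0 := box_gt0 bx.
set v0 := c (pi x) in bx *.
pose K s := closed_ball v0 s.
have KB s : 0 < s -> s < r -> K s `<=` ball v0 r.
  by move=> s0 sr v; rewrite /K closed_ballE//= -ball_normE /closed_ball_ /=; lra.
have cK s : 0 < s -> compact (K s).
  move=> s0; apply: bounded_closed_compact; last exact: closed_ball_closed.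
  exists (`|v0| + s); split; first exact: num_real.
  move=> m /ltW mle v; rewrite /K closed_ballE /closed_ball_//= => Kv.
  apply: le_trans mle; have := ler_distD v0 v 0.
  by rewrite !subr0 (distrC v); lra.
(* Pairs of a starting point in the inner box and a frontier point of the half box in the same
   plaque. The two are distinct, so the distance is positive on the compact set [S]; [eta] is a
   lower bound for it. *)
pose S := (K (r / 4) `*` (K (r / 2) `&` ~` ball v0 (r / 2))) `&`
  [set p : 'rV[R]_(2 + 1) * 'rV[R]_(2 + 1) |
    p.1 0 ord_max - p.2 0 ord_max = 0].
have cS : compact S.
  apply: compact_closedI.
    apply: compact_setX; first by apply: cK; lra.
    apply: compact_closedI; first by apply: cK; lra.
    by apply: open_closedC; exact: ball_open.
  have cc : continuous (fun p : 'rV[R]_(2 + 1) * 'rV[R]_(2 + 1) =>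
      p.1 0 ord_max - p.2 0 ord_max).
    move=> p; pose l (v : 'rV[R]_(2 + 1)) := v 0 ord_max.
    have cl : continuous l by exact: coord_continuous.
    have c1 : {for p, continuous (l \o fst)}.
      by apply: continuous_comp; [exact: cvg_fst | exact: cl].
    have c2 : {for p, continuous (l \o snd)}.
      by apply: continuous_comp; [exact: cvg_snd | exact: cl].
    exact: cvgB c1 c2.
  by apply: (preimage_closed (D := [set u : R | u = 0])) => //; exact: closed_eq.
pose f (p : 'rV[R]_(2 + 1) * 'rV[R]_(2 + 1)) := D (k p.1) (k p.2).
have SP p : S p -> [/\ ball v0 r p.1, ball v0 r p.2, lifted_leaf pi F (k p.1) (k p.2)
   & 0 < f p].
  move=> [[/= K1 [K2 nB]] /subr0_eq p12].
  have B1 : ball v0 r p.1 by apply: KB K1; lra.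
  have B2 : ball v0 r p.2 by apply: KB K2; lra.
  have lf : lifted_leaf pi F (k p.1) (k p.2) by exact: (box_leaf bx B1 B2 p12).
  split=> //; rewrite /f lt_def ldist_ge0// andbT.
  apply/eqP => /(ldist_eq0 D lf) /(box_inj bx B1 B2) E; apply: nB; rewrite -E.
  by move: K1; rewrite /K closed_ballE /closed_ball_ -?ball_normE/=; lra.
have cf : {within S, continuous f}.
  apply/subspace_continuousP => p Sp; have [B1 B2 lf _] := SP _ Sp.
  apply/cvgrPdist_lt => e e0.
  have [[P Q] [/= nP nQ] sub] := leaf_metric_near lf e0.
  have n1 : nbhs p.1 (k @^-1` P) by apply: (box_cont bx B1).
  have n2 : nbhs p.2 (k @^-1` Q) by apply: (box_cont bx B2).
  have n12 : nbhs p [set q | P (k q.1) /\ Q (k q.2)].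
    by exists (k @^-1` P, k @^-1` Q).
  apply: filterS n12 => q /= [Pq Qq] Sq; have [_ _ lq _] := SP _ Sq.
  exact: (sub (k q.1, k q.2)).
have cfS : closed (f @` S).
  by apply: compact_closed; [exact: norm_hausdorff|exact: continuous_compact].
have nf0 : (~` (f @` S)) 0.
  by move=> [p /SP[_ _ _ + p0]]; rewrite p0 ltxx.
have [eta /= eta0 etaS] : exists2 eta, 0 < eta & ball 0 eta `<=` ~` (f @` S).
  by apply/nbhs_ballP; apply: open_nbhs_nbhs; split=> //; exact: closed_openC.
have fS p : S p -> eta <= f p.
  move=> Sp; rewrite leNgt; apply/negP => fe; apply: (etaS (f p)); last by exists p.
  by rewrite /ball /= sub0r normrN gtr0_norm//; case: (SP _ Sp).
exists eta => //.
have B0 : ball v0 r v0 by exact: ballxx.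
have near_x : \forall y \near x, (cdom c (pi y) /\ k (c (pi y)) = y) /\
    ball v0 (r / 4) (c (pi y)).
  have := box_near bx B0; rewrite /v0 (box_center bx) => nx.
  apply: filterI nx _.
  have := box_coord_continuous cov bx B0; rewrite /v0 (box_center bx) => cx.
  apply: cx; apply: nbhsx_ballx; lra.
apply: filterS near_x => y [[cy ky] By] z yz yze.
have By' : ball v0 r (c (pi y)) by apply: le_ball By; lra.
have [g [cg g0 g1 gl gD]] := leaf_segment yz.
pose v := c (pi y).
pose P := [set w : 'rV[R]_(2 + 1) | trans_coord w = trans_coord v].
(* The times at which the segment lies in the plaque of [y] inside the half box; this set is
   nonempty, open and closed. *)
pose Q := [set t | (k @` (ball v0 (r / 2) `&` P)) (g t)].
have half w : ball v0 (r / 2) w -> ball v0 r w by apply: le_ball; lra.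
have oQ : open Q.
  rewrite openE => t [w [Bw Pw] kw].
  have n1 : nbhs t (g @^-1` [set u | (cdom c (pi u) /\ k (c (pi u)) = u) /\
      ball v0 (r / 2) (c (pi u))]).
    apply: cg; rewrite -kw; apply: filterI; first exact: (box_near bx (half _ Bw)).
    apply: (box_coord_continuous cov bx (half _ Bw)) => /=.
    rewrite (boxE bx (half _ Bw)); apply: open_nbhs_nbhs; split=> //.
    exact: ball_open.
  have n2 : \forall s \near t, cdom c (pi (g s)) /\
      trans_coord (c (pi (g s))) = trans_coord (c (pi (g t))).
    apply: (@leaf_path_trans _ _ F (pi \o g) c (pi y)) => //; last 2 first.
    - by move=> u; rewrite (lifted_leaf_leaf (gl u)); exact: same_leaf_refl.
    - by rewrite /= -kw; exact: (box_dom_pi bx (half _ Bw)).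
    - exact: box_atlas bx.
    - by move=> u; apply: continuous_comp; [exact: cg | exact: (covering_continuous cov)].
  apply: filterS2 n1 n2 => s [[cs ks] Bs] [_ E].
  exists (c (pi (g s))) => //; split=> //; rewrite /P /= E -kw.
  by rewrite (boxE bx (half _ Bw)).
have clQ : closed Q.
  have cK' : compact (K (r / 2) `&` P).
    apply: compact_closedI; first by apply: cK; lra.
    apply: (preimage_closed (D := [set u : R | u = trans_coord v])); last exact: closed_eq.
    by move=> w _; exact: coord_continuous.
  have clK : closed (k @` (K (r / 2) `&` P)).
    apply: compact_closed; first exact: (covering_hausdorff cov).
    apply: continuous_compact => //; apply: continuous_in_subspaceT => w.
    by rewrite inE => -[Kw _]; apply: (box_cont bx); apply: KB Kw; lra.
  (* Closing the ball changes nothing: frontier points in this plaque are at distance at least [eta]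
     from [y], and the segment stays closer. *)
  have -> : Q = g @^-1` (k @` (K (r / 2) `&` P)).
    apply/seteqP; split=> t [w [Bw Pw] kw].
      by exists w => //; split=> //; exact: subset_closure.
    exists w => //; split=> //; apply: contrapT => nB.
    have := fS (v, w); rewrite /f /= ky kw leNgt => /(_ _)/negP; apply.
      split=> /=; last by move: Pw; rewrite /P /= /trans_coord => ->; rewrite subrr.
      by split=> //; exact: subset_closure.
    exact: le_lt_trans (gD t) yze.
  by apply: preimage_closed => // t _; exact: cg.
have QT : Q = setT.
  have cR : connected [set: R] by apply/connected_intervalP.
  apply: cR; last 2 first.
  - by exists Q => //; rewrite setTI.
  - by exists Q => //; rewrite setTI.
  - exists 0; exists v; last by rewrite g0.
    by split=> //; apply: le_ball By; lra.
have : Q 1 by rewrite QT.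
by move=> [w [Bw _] kw]; rewrite -g1 -kw; exact: (box_sub bx (half _ Bw)).
Qed.
End LeafMetric.

(** * The unit speed flow *)

Section LeafLines.
Context {R : realType} {X M : topologicalType} (pi : X -> M) (F : @foliation R M).
Context (D : leaf_metric pi F).
Context (x : X) (h : R * R -> X) (hi : leaf_isometry D x h).

Lemma isometry_inj z w : 0 < z.2 -> 0 < w.2 -> h z = h w -> z = w.
Proof.
move=> z0 w0 zw; have lzw := isometry_leaf hi z0 w0.
have /esym := isometry_dcosh hi z0 w0.
rewrite (ldist_eq0 D lzw).2// dcosh0 /hyp_form => E.
have {E} : (z.1 - w.1) ^+ 2 + (z.2 - w.2) ^+ 2 = 0.
  have : (z.1 - w.1) ^+ 2 + z.2 ^+ 2 + w.2 ^+ 2 = 2 * (z.2 * w.2).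
    by rewrite -E divfK// gt_eqF// mulr_gt0.
  by lra.
have := sqr_ge0 (z.1 - w.1); have := sqr_ge0 (z.2 - w.2) => h1 h2 h3.
have /eqP : (z.1 - w.1) ^+ 2 = 0 by lra.
have /eqP : (z.2 - w.2) ^+ 2 = 0 by lra.
rewrite !sqrf_eq0 !subr_eq0 => /eqP e2 /eqP e1.
by rewrite [z]surjective_pairing [w]surjective_pairing e1 e2.
Qed.

Lemma isometry_line (v : R -> X) : lifted_leaf pi F x (v 0) -> geodesic D v ->
  exists gamma : R -> R * R, [/\ forall t, 0 < (gamma t).2,
    forall t, h (gamma t) = v t &
    exists a p q b r s, geodesic_coefs gamma a p q b r s].
Proof.
move=> xv gv.
have H t : exists z, 0 < z.2 /\ h z = v t.
  have [|z z0 hz] := isometry_surj hi (y := v t); last by exists z.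
  by apply: lifted_leaf_trans xv _; case: (gv 0 t).
have [gamma Hg] := choice H.
have g0 t : 0 < (gamma t).2 by have [] := Hg t.
have hg t : h (gamma t) = v t by have [] := Hg t.
exists gamma; split=> //; apply: exp_line => // s t.
by rewrite -(isometry_dcosh hi)// !hg; have [_ ->] := gv s t; rewrite dcosh_norm.
Qed.

Lemma line_isometry (gamma : R -> R * R) : (forall t, 0 < (gamma t).2) ->
  (forall s t, hyp_form (gamma s) (gamma t) = dcosh (s - t)) ->
  geodesic D (h \o gamma).
Proof.
move=> g0 gB s t /=; split; first exact: (isometry_leaf hi).
by rewrite (isometry_dist hi)//; apply: hyp_dist_eq => //; rewrite gB dcosh_norm.
Qed.
End LeafLines.

Section Reparametrization.
Context {R : realType} (s : R -> R).
Hypothesis rs : reparametrization s.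

Lemma repar_mono : {mono s : a b / a <= b}.
Proof. by have [_ + _ _] := rs => /le_mono. Qed.

Lemma repar_mono_lt : {mono s : a b / a < b}.
Proof. exact: leW_mono repar_mono. Qed.

Lemma repar_inj : injective s.
Proof. exact: inc_inj repar_mono. Qed.

Lemma repar_surj u : exists t, s t = u.
Proof.
have [_ _ rng _] := rs; have : [set: R] u by [].
by rewrite -rng => -[t _ <-]; exists t.
Qed.

Lemma repar0 : s 0 = 0. Proof. by case: rs. Qed.

Lemma repar_ge0 t : (0 <= s t) = (0 <= t).
Proof. by rewrite -{1}repar0 repar_mono. Qed.
End Reparametrization.

Section UnitSpeed.
Context {R : realType} {X M : topologicalType} (pi : X -> M) (F : @foliation R M).
Context (lphi : flow R X) (D : leaf_metric pi F) (ad : adapted lphi D).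

(** The distance to [x] determines the arc length parameter up to sign, and the direction of the
    flow determines the sign. *)
Lemma orbit_geodesic_unique x (v w : unit_tangent D) :
  orbit_geodesic lphi x v -> orbit_geodesic lphi x w -> line v =1 line w.
Proof.
move=> [s rs sE] [s' rs' s'E] t.
have [u su] := repar_surj rs (s' t).
have vw : line v u = line w t by rewrite sE s'E su.
have v0 : line v 0 = x by rewrite sE (repar0 rs) flow0.
have w0 : line w 0 = x by rewrite s'E (repar0 rs') flow0.
have ut : `|u| = `|t|.
  have [_] := line_geodesic v 0 u; have [_] := line_geodesic w 0 t.
  by rewrite v0 w0 vw !sub0r !normrN => <- <-.
have sg : (0 <= u) = (0 <= t).
  by rewrite -(repar_ge0 rs) su (repar_ge0 rs').
rewrite -vw; congr (line v _); move: ut sg.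
case: (ger0P u) => u0; case: (ger0P t) => t0 //; lra.
Qed.

Definition unit_flow (t : R) (x : X) : X := line (orbit_line ad x) t.

Lemma orbit_lineP x : orbit_geodesic lphi x (orbit_line ad x).
Proof. by rewrite /orbit_line; case: cid. Qed.

Definition unit_time (x : X) : R -> R := sval (cid2 (orbit_lineP x)).

Lemma unit_time_repar x : reparametrization (unit_time x).
Proof. by rewrite /unit_time; case: cid2. Qed.

Lemma unit_flowE t x : unit_flow t x = lphi (unit_time x t) x.
Proof. by rewrite /unit_time /unit_flow; case: cid2. Qed.

Lemma unit_flow0 x : unit_flow 0 x = x.
Proof. by rewrite unit_flowE (repar0 (unit_time_repar x)) flow0. Qed.

Lemma unit_flow_geodesic x : geodesic D (unit_flow ^~ x).
Proof. exact: line_geodesic. Qed.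

Lemma unit_flow_dist s t x : D (unit_flow s x) (unit_flow t x) = `|s - t|.
Proof. by have [] := unit_flow_geodesic x s t. Qed.

Lemma unit_flow_leaf t x : lifted_leaf pi F x (unit_flow t x).
Proof. by have [+ _] := unit_flow_geodesic x 0 t; rewrite unit_flow0. Qed.

Lemma flow_unit_flow u x : exists2 t, unit_time x t = u & lphi u x = unit_flow t x.
Proof.
have [t tE] := repar_surj (unit_time_repar x) u.
by exists t => //; rewrite unit_flowE tE.
Qed.

Lemma flow_leaf u x : lifted_leaf pi F x (lphi u x).
Proof. by have [t _ ->] := flow_unit_flow u x; exact: unit_flow_leaf. Qed.

Lemma flow_leaf2 u x y : lifted_leaf pi F x y ->
  lifted_leaf pi F (lphi u x) (lphi u y).
Proof.
move=> xy; apply: lifted_leaf_trans (flow_leaf u y).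
by apply: lifted_leaf_trans xy; exact/lifted_leaf_sym/flow_leaf.
Qed.

Lemma unit_flowD s t x : unit_flow (s + t) x = unit_flow s (unit_flow t x).
Proof.
have gsh : geodesic D (fun u => unit_flow (u + t) x).
  move=> a b; split; first by have [] := unit_flow_geodesic x (a + t) (b + t).
  by rewrite unit_flow_dist; congr (`|_|); ring.
have -> : unit_flow (s + t) x = line (mk_unit_tangent gsh) s by [].
apply: orbit_geodesic_unique (orbit_lineP _) s.
have rs := unit_time_repar x; set sg := unit_time x in rs.
exists (fun u => sg (u + t) - sg t); last first.
  by move=> u; rewrite -[LHS]/(unit_flow (u + t) x) !unit_flowE -flowD subrK.
have [cs ms rng s0] := rs; split.
- move=> u; apply: cvgB; last exact: cvg_cst.
  apply: (@continuous_comp _ _ _ (fun u : R => u + t) sg); last exact: cs.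
  by apply: cvgD; [exact: cvg_id | exact: cvg_cst].
- by move=> a b ab; rewrite ltrD2r ms// ltrD2r.
- rewrite predeqE => u; split=> // _; have [v vE] := repar_surj rs (u + sg t).
  by exists (v - t) => //; rewrite subrK vE addrK.
- by rewrite add0r subrr.
Qed.

Lemma flow_continuous_time x : continuous (lphi ^~ x).
Proof.
move=> t; have ct : {for t, continuous (fun u : R => (u, x))}.
  by apply: continuous_pair; [exact: cvg_id | exact: cvg_cst].
exact: (continuous_comp ct (@flow_cont _ _ lphi (t, x))).
Qed.

Lemma flow_continuous_point u : continuous (lphi u).
Proof.
move=> x; have ct : {for x, continuous (fun y : X => (u, y))}.
  by apply: continuous_pair; [exact: cvg_cst | exact: cvg_id].
exact: (continuous_comp ct (@flow_cont _ _ lphi (u, x))).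
Qed.

Lemma leaf_metric_continuous_for (S : topologicalType) (f g : S -> X) x :
  {for x, continuous f} -> {for x, continuous g} ->
  (\forall y \near x, lifted_leaf pi F (f y) (g y)) ->
  {for x, continuous (fun y => D (f y) (g y))}.
Proof.
move=> cf cg fg; apply/cvgrPdist_lt => e e0.
have [[P Q] [/= nP nQ] sub] :=
  leaf_metric_near (adapted_continuous ad) (nbhs_singleton fg) e0.
have nf : nbhs x (f @^-1` P) by exact: cf.
have ng : nbhs x (g @^-1` Q) by exact: cg.
by apply: filterS3 nf ng fg => y Py Qy; apply: (sub (f y, g y)).
Qed.

(* The arc length parameter of [lphi u x]; measuring distances from [lphi |u| x]
   gives it with its sign. *)
Definition reach_time (u : R) (x : X) : R :=
  D x (lphi `|u| x) - D (lphi u x) (lphi `|u| x).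

Lemma reach_timeE u x : unit_time x (reach_time u x) = u.
Proof.
have [n nE nf] := flow_unit_flow `|u| x; have [t tE tf] := flow_unit_flow u x.
have rs := unit_time_repar x.
have n0 : 0 <= n by rewrite -(repar_ge0 rs) nE.
have tn : t <= n by rewrite -(repar_mono rs) nE tE ler_norm.
have d0 : D x (unit_flow n x) = `|0 - n| by rewrite -(unit_flow_dist 0 n x) unit_flow0.
rewrite /reach_time nf tf d0 unit_flow_dist sub0r normrN.
rewrite ger0_norm// ler0_norm ?subr_le0//.
by rewrite (_ : n - - (t - n) = t)//; lra.
Qed.

Lemma reach_time_continuous u : continuous (reach_time u).
Proof.
move=> x; apply: cvgB.
  apply: leaf_metric_continuous_for; first exact: cvg_id.
    exact: flow_continuous_point.
  by apply: nearW => y; exact: flow_leaf.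
apply: leaf_metric_continuous_for; [exact: flow_continuous_point..|].
apply: nearW => y; apply: lifted_leaf_trans (flow_leaf _ _).
exact/lifted_leaf_sym/flow_leaf.
Qed.

(** [reach_time] inverts the increasing map [unit_time] in the time variable, so a bound on
    [unit_time] amounts to two strict inequalities on [reach_time], which is continuous in the
    point. *)
Lemma unit_time_continuous : continuous (fun p : R * X => unit_time p.2 p.1).
Proof.
move=> [t0 x0]; apply/cvgrPdist_lt => e e0 /=.
pose s0 := unit_time x0 t0.
have side u : {for (t0, x0), continuous (fun p : R * X => p.1 - reach_time u p.2)}.
  have cr : {for (t0, x0), continuous (reach_time u \o snd)}.
    by apply: continuous_comp; [exact: cvg_snd | exact: reach_time_continuous].
  by apply: cvgB; [exact: cvg_fst | exact: cr].
have lo : 0 < t0 - reach_time (s0 - e) x0.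
  rewrite subr_gt0 -(repar_mono_lt (unit_time_repar x0)) reach_timeE -/s0; lra.
have hi : t0 - reach_time (s0 + e) x0 < 0.
  rewrite subr_lt0 -(repar_mono_lt (unit_time_repar x0)) reach_timeE -/s0; lra.
have n1 : nbhs (t0, x0) [set p : R * X | 0 < p.1 - reach_time (s0 - e) p.2].
  exact: (cvgr_gt _ (side (s0 - e)) _ lo).
have n2 : nbhs (t0, x0) [set p : R * X | p.1 - reach_time (s0 + e) p.2 < 0].
  exact: (cvgr_lt _ (side (s0 + e)) _ hi).
suff : nbhs (t0, x0) [set p : R * X | `|unit_time x0 t0 - unit_time p.2 p.1| < e].
  by [].
apply: filterS2 n1 n2 => -[t x] /=; rewrite subr_gt0 subr_lt0.
rewrite -[_ < t](repar_mono_lt (unit_time_repar x)) -[t < _](repar_mono_lt (unit_time_repar x)).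
rewrite !reach_timeE => h1 h2.
by rewrite -/s0 distrC ltr_distl h1 h2.
Qed.

Lemma unit_flow_continuous : continuous (fun p : R * X => unit_flow p.1 p.2).
Proof.
have -> : (fun p : R * X => unit_flow p.1 p.2) =
    (fun p : R * X => lphi p.1 p.2) \o (fun p => (unit_time p.2 p.1, p.2)).
  by apply/funext => -[t x]; rewrite /= unit_flowE.
move=> p; apply: continuous_comp; last exact: flow_cont.
by apply: continuous_pair; [exact: unit_time_continuous | exact: cvg_snd].
Qed.

Lemma unit_flow_continuous_point t : continuous (unit_flow t).
Proof.
move=> x; have ct : {for x, continuous (fun y : X => (t, y))}.
  by apply: continuous_pair; [exact: cvg_cst | exact: cvg_id].
have cc : {for (t, x), continuous (fun p : R * X => unit_flow p.1 p.2)}.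
  exact: unit_flow_continuous.
exact: (continuous_comp ct cc).
Qed.
End UnitSpeed.

(** * Leaf coordinates adapted to the orbits *)

Section OrbitChart.
Context {R : realType} {X M : topologicalType} (pi : X -> M) (F : @foliation R M).
Context (lphi : flow R X) (D : leaf_metric pi F) (ad : adapted lphi D).

Lemma strong_leafC x y : strong_leaf lphi D x y -> strong_leaf lphi D y x.
Proof.
move=> [xy c]; split; first exact: lifted_leaf_sym.
have -> // : (fun t => D (lphi t y) (lphi t x)) = (fun t => D (lphi t x) (lphi t y)).
apply/funext => t; apply: ldist_sym; apply: (flow_leaf2 ad).
exact: lifted_leaf_sym.
Qed.

Lemma strong_leaf_trans x y z : strong_leaf lphi D x y ->
  strong_leaf lphi D y z -> strong_leaf lphi D x z.
Proof.
move=> [xy c1] [yz c2]; have xz := lifted_leaf_trans xy yz; split=> //.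
apply: (@squeeze_cvgr _ _ _ _ (fun=> 0)
  (fun t => D (lphi t x) (lphi t y) + D (lphi t y) (lphi t z))).
- apply: nearW => t; apply/andP; split.
    by apply: ldist_ge0; exact: (flow_leaf2 ad).
  by apply: ldist_triangle; exact: (flow_leaf2 ad).
- exact: cvg_cst.
- by rewrite -[0]addr0; exact: cvgD.
Qed.

Lemma strong_leaf_flow u x y : strong_leaf lphi D x y ->
  strong_leaf lphi D (lphi u x) (lphi u y).
Proof.
move=> [xy c]; split; first exact: (flow_leaf2 ad).
have -> : (fun t => D (lphi t (lphi u x)) (lphi t (lphi u y))) =
    (fun t => D (lphi t x) (lphi t y)) \o (fun t => t + u).
  by apply/funext => t; rewrite /= !flowD.
by apply: cvg_comp c; exact: cvg_addrr_Ny.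
Qed.

(** Strong leaves converge at equal flow times, whereas half-plane computations use arc length;
    separate parameters [u] and [v] are enough for [backward_null_form]. *)
Lemma strong_leaf_backward x y N : strong_leaf lphi D x y ->
  exists u v, [/\ u <= - N, v <= - N &
    D (unit_flow ad u x) (unit_flow ad v y) <= 1].
Proof.
move=> [xy c].
pose T := Num.min (unit_time ad x (- N)) (unit_time ad y (- N)).
have n1 : \forall t \near -oo, t <= T by exact: nbhs_ninfty_le (num_real _).
have n2 : \forall t \near -oo, D (lphi t x) (lphi t y) < 1.
  exact: cvgr_lt c _ ltr01.
have [t [tT t1]] := filter_ex (filterI n1 n2).
have [u uE uf] := flow_unit_flow ad t x; have [v vE vf] := flow_unit_flow ad t y.
exists u, v; move: tT; rewrite /= /T le_min => /andP[tx ty]; split.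
- by rewrite -(repar_mono (unit_time_repar ad x)) uE.
- by rewrite -(repar_mono (unit_time_repar ad y)) vE.
- by rewrite -uf -vf ltW.
Qed.

Section Horocycle.
Context (x : X) (h : R * R -> X) (hi : leaf_isometry D x h).
Hypothesis hS : strong_leaf lphi D x = h @` [set z | z.2 = 1].

Lemma horo_strong a : strong_leaf lphi D x (h (a, 1)).
Proof. by rewrite hS; exists (a, 1). Qed.

Lemma horo_coefs a : exists gamma, [/\ forall t, 0 < (gamma t).2,
  forall t, h (gamma t) = unit_flow ad t (h (a, 1)), gamma 0 = (a, 1) &
  exists c p q b r s, geodesic_coefs gamma c p q b r s].
Proof.
have [||gamma [g0 hg gc]] := isometry_line hi (v := unit_flow ad ^~ (h (a, 1))).
- by rewrite unit_flow0; apply: (isometry_in hi).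
- exact: unit_flow_geodesic.
exists gamma; split=> //; apply: (isometry_inj hi) => //=.
by rewrite hg unit_flow0.
Qed.

(* Strong leaves are permuted by the flow, so a second point of the orbit on the
   horocycle would give a third one. *)
Lemma horo_once a t : (unit_flow ad t (h (a, 1)) \in h @` [set z | z.2 = 1]) ->
  t = 0.
Proof.
rewrite -hS inE => St; apply: contrapT => t0.
have [gamma [g0 hg gE [c [p [q [b [r [s gc]]]]]]]] := horo_coefs a.
have level u : strong_leaf lphi D x (unit_flow ad u (h (a, 1))) ->
    c * expR u + b * expR (- u) = 1.
  rewrite hS => -[z /= z1 hz]; rewrite -(gc_inv gc).
  suff -> : gamma u = z by rewrite z1 invr1.
  by apply: (isometry_inj hi) => //; [rewrite z1 | rewrite hg hz].
set P := h (a, 1) in St hg level.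
have sP : strong_leaf lphi D P (unit_flow ad t P).
  exact: strong_leaf_trans (strong_leafC (horo_strong a)) St.
(* The displacement is doubled in flow time, since it is [lphi] that permutes the strong leaves;
   [tau] is the arc length parameter of the resulting point. *)
have [tau tauE tauf] := flow_unit_flow ad (unit_time ad P t + unit_time ad P t) P.
have sP2 : strong_leaf lphi D x (unit_flow ad tau P).
  apply: strong_leaf_trans St _; rewrite -tauf flowD -unit_flowE.
  by rewrite {1}unit_flowE; exact: strong_leaf_flow.
have rs := unit_time_repar ad P.
have st0 : unit_time ad P t <> 0.
  by rewrite -(repar0 rs) => /(repar_inj rs).
have tau0 : tau <> 0 by move=> E; move: tauE; rewrite E (repar0 rs); lra.
have taut : tau <> t by move=> E; move: tauE; rewrite E; lra.
have l0 : c + b = 1.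
  by have := level 0; rewrite unit_flow0 oppr0 expR0 !mulr1; apply; exact: horo_strong.
have lt := level _ St; have ltau := level _ sP2.
(* With [X = expR u], the equation [c * X ^+ 2 - X + b = 0] has the root 1, so any other root
   satisfies [c * X = b]; [t] and [tau] would both be given by it. *)
have fac u : u <> 0 -> c * expR u + b * expR (- u) = 1 -> c * expR u = b.
  move=> u0; rewrite expRN; have eu := expR_gt0 u.
  have eu1 : expR u - 1 != 0.
    by rewrite subr_eq0 -expR0; apply/eqP => /expR_inj.
  move: (expR u) eu eu1 => e eu eu1 ce; apply: (mulIf eu1).
  have ce' : c * e ^+ 2 + b = e.
    by rewrite -[RHS]mul1r -ce; field; lra.
  have -> : b = 1 - c by lra.
  by rewrite (_ : b = 1 - c) in ce'; [lra | lra].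
have e1 := fac _ t0 lt; have e2 := fac _ tau0 ltau.
have c0 : c != 0.
  apply/eqP => c0; move: e1 l0; rewrite c0 mul0r add0r => <-; lra.
by apply: taut; apply: expR_inj; apply: (mulfI c0); rewrite e1 e2.
Qed.
End Horocycle.

(* A half-plane coordinate on a leaf in which the common backward end of the
   orbits is at infinity. *)
Definition orbit_chart (x : X) (h : R * R -> X) : Prop :=
  leaf_isometry D x h /\ forall a b t, 0 < b ->
    unit_flow ad t (h (a, b)) = h (a, b * expR (- t)).

Lemma exists_orbit_chart x : exists h, orbit_chart x h.
Proof.
have [h hi hS] := adapted_horocycle ad x; exists h; split=> //.
have vert a t : unit_flow ad t (h (a, 1)) = h (a, expR (- t)).
  have [gamma [g0 hg gE [c [p [q [b [r [s gc]]]]]]]] := horo_coefs hi a.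
  have [b0|b0] := eqVneq b 0.
    by rewrite -hg (geodesic_coefs_down t g0 gc b0) gE mul1r.
  (* All orbits through the horocycle have the same backward end [r / b]; the
     one through [(r / b + 2, 1)] returns to height 1 at time [ln (1 / 4)]. *)
  have bpos : 0 < b by rewrite lt_def b0; have [] := gc_ge0 gc.
  pose a' := r / b + 2.
  have [gamma' [g0' hg' gE' [c' [p' [q' [b' [r' [s' gc']]]]]]]] := horo_coefs hi a'.
  have O : b * s' + s * b' - 2 * r * r' = 0.
    apply: (backward_null_form (K := dcosh 1) g0 g0' gc gc') => N.
    have S : strong_leaf lphi D (h (a, 1)) (h (a', 1)).
      exact: strong_leaf_trans (strong_leafC (horo_strong hS a)) (horo_strong hS a').
    have [u [v [uN vN uv]]] := strong_leaf_backward N S.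
    exists u, v; split=> //.
    by have := isometry_le hi (g0 u) (g0' v) ler01; rewrite hg hg' uv => /esym.
  have [_ b'ge q'ge s'ge] := gc_ge0 gc'.
  have nz : r' ^+ 2 + s' ^+ 2 + b' ^+ 2 != 0.
    have h1 := sqr_ge0 r'; have h2 := sqr_ge0 s'; have h3 := sqr_ge0 b'.
    apply/eqP => E; have /eqP : r' ^+ 2 = 0 by lra.
    have /eqP : s' ^+ 2 = 0 by lra.
    have /eqP : b' ^+ 2 = 0 by lra.
    rewrite !sqrf_eq0 => /eqP b'0 /eqP s'0 /eqP r'0.
    by have := gc_AC gc'; rewrite b'0 s'0 r'0; lra.
  have [b'0 e'] := null_proportional bpos b'ge (gc_nullC gc) (gc_nullC gc') O nz.
  (* By the horocycle equation [b'^-1] is [2 ^+ 2 + 1 = 5], so [c' = 4 / 5], and the times at height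
     1 have exponentials 1 and 1 / 4. An offset of 1 in place of 2 would give a double root. *)
  have := geodesic_coefs_back g0' gc' b'0; rewrite gE' /= e' /a'.
  have -> : ((r / b + 2 - r / b) ^+ 2 + 1 ^+ 2) / 1 = 5 :> R by rewrite divr1; ring.
  move=> /(congr1 GRing.inv); rewrite invrK => b'E.
  have := gc_inv gc' 0; rewrite gE' /= invr1 oppr0 expR0 !mulr1 => c'E.
  have quarter : 0 < 4^-1 :> R by rewrite invr_gt0.
  have ln4 : ln 4^-1 = 0 :> R.
    apply: (horo_once hi hS (a := a')); rewrite inE; exists (gamma' (ln 4^-1)).
      rewrite /= -[LHS]invrK (gc_inv gc') expRN lnK ?posrE// invrK -b'E.
      by rewrite (_ : c' = 1 - 5^-1); [field | lra].
    exact: hg'.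
  have : expR (ln 4^-1) = 1 :> R by rewrite ln4 expR0.
  rewrite lnK ?posrE// => /(congr1 GRing.inv); rewrite invrK invr1 => /eqP.
  by rewrite (eqr_nat R 4 1).
move=> a b t b0.
have -> : h (a, b) = unit_flow ad (- ln b) (h (a, 1)).
  by rewrite vert opprK lnK.
by rewrite -unit_flowD vert opprD opprK expRD mulrC lnK.
Qed.
End OrbitChart.

(** * Endpoints of orbits *)

Section Ends.
Context {R : realType} {X M : topologicalType} (pi : X -> M) (F : @foliation R M).
Context (lphi : flow R X) (D : leaf_metric pi F) (ad : adapted lphi D).

Lemma forward_endP (v w : unit_tangent D) :
  forward_end v = forward_end w <-> asymptotic v w.
Proof.
split=> [E|vw]; first by apply/asboolP/(@eqmodP _ (asymptotic_equiv D)).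
by apply/eqmodP/asboolP.
Qed.

Lemma forward_end_eq_line (v w : unit_tangent D) : line v =1 line w ->
  forward_end v = forward_end w.
Proof.
move=> vw; apply/forward_endP; split; first by rewrite vw; exact: line_leaf.
exists 0 => t _; rewrite vw; have [_ ->] := line_geodesic w t t.
by rewrite subrr normr0.
Qed.

Lemma forward_endpoint_unit_flow c x :
  forward_endpoint ad (unit_flow ad c x) = forward_endpoint ad x.
Proof.
apply/forward_endP; split.
  have -> : line (orbit_line ad (unit_flow ad c x)) 0 = unit_flow ad c x.
    exact: unit_flow0.
  have -> : line (orbit_line ad x) 0 = x by exact: unit_flow0.
  exact/lifted_leaf_sym/unit_flow_leaf.
exists `|c| => t _.
rewrite -[line (orbit_line ad x) t]/(unit_flow ad t x).
rewrite -[line (orbit_line ad (unit_flow ad c x)) t]/(unit_flow ad t _).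
by rewrite -unit_flowD unit_flow_dist [t + c]addrC addrK.
Qed.

Lemma forward_endpoint_flow u x :
  forward_endpoint ad (lphi u x) = forward_endpoint ad x.
Proof.
by have [t _ ->] := flow_unit_flow ad u x; exact: forward_endpoint_unit_flow.
Qed.

Lemma orbit_chart_coord x h y : orbit_chart ad x h -> lifted_leaf pi F x y ->
  exists a b, [/\ 0 < b, y = h (a, b) &
    forall t, unit_flow ad t y = h (a, b * expR (- t))].
Proof.
move=> [hi hv] /(isometry_surj hi)[[a b] /= b0 <-].
by exists a, b; split=> // t; exact: hv.
Qed.

Section OneLeaf.
Context (x : X) (h : R * R -> X) (hc : orbit_chart ad x h).
Let hi : leaf_isometry D x h := hc.1.

Lemma asymptotic_in_chart (v w : unit_tangent D) (g g' : R -> R * R) K :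
  (forall t, 0 < (g t).2) -> (forall t, 0 < (g' t).2) ->
  (forall t, line v t = h (g t)) -> (forall t, line w t = h (g' t)) ->
  (forall t, 0 <= t -> hyp_form (g t) (g' t) <= K) -> forward_end v = forward_end w.
Proof.
move=> g0 g0' vg wg' H; apply/forward_endP; split.
  by rewrite vg wg'; exact: (isometry_leaf hi).
exists (ln K) => t t0; rewrite vg wg'; apply: dcosh_le_ln.
by rewrite (isometry_dcosh hi)// H.
Qed.

Lemma asymptotic_bound (v w : unit_tangent D) (g g' : R -> R * R) :
  (forall t, 0 < (g t).2) -> (forall t, 0 < (g' t).2) ->
  (forall t, line v t = h (g t)) -> (forall t, line w t = h (g' t)) ->
  forward_end v = forward_end w ->
  exists K, forall t, 0 <= t -> hyp_form (g t) (g' t) <= K.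
Proof.
move=> g0 g0' vg wg' /forward_endP[_ [B HB]]; exists (dcosh B) => t t0.
have := HB _ t0; rewrite vg wg' => DB.
have B0 : 0 <= B.
  by apply: le_trans DB; apply: ldist_ge0; exact: (isometry_leaf hi).
by rewrite -(isometry_le hi).
Qed.

Lemma down_gt0 (b t : R) : 0 < b -> 0 < b * expR t.
Proof. by move=> b0; rewrite mulr_gt0// expR_gt0. Qed.

Lemma backward_end_chart y z : lifted_leaf pi F x y -> lifted_leaf pi F x z ->
  backward_end (orbit_line ad y) = backward_end (orbit_line ad z).
Proof.
move=> /(orbit_chart_coord hc)[a [b [b0 _ yE]]] /(orbit_chart_coord hc)[a' [b' [b'0 _ zE]]].
have line_rev u w : line (mk_unit_tangent (reverse_geodesic (orbit_line ad u))) w =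
  unit_flow ad (- w) u by [].
apply: (@asymptotic_in_chart _ _ (fun t => (a, b * expR t)) (fun t => (a', b' * expR t))
  (((a - a') ^+ 2 + b ^+ 2 + b' ^+ 2) / (b * b'))).
- by move=> t; exact: down_gt0.
- by move=> t; exact: down_gt0.
- by move=> t; rewrite line_rev// yE opprK.
- by move=> t; rewrite line_rev// zE opprK.
move=> t t0; rewrite /hyp_form /=.
have et : 1 <= expR t by rewrite -expR0 ler_expR.
move: (expR t) et => e e1.
have -> : ((a - a') ^+ 2 + (b * e) ^+ 2 + (b' * e) ^+ 2) / (b * e * (b' * e)) =
  ((a - a') ^+ 2 * e^-1 ^+ 2 + b ^+ 2 + b' ^+ 2) / (b * b') by field; lra.
have bb : 0 < b * b' by exact: mulr_gt0.
rewrite ler_pM2r ?invr_gt0// !lerD2r ler_piMr ?sqr_ge0//.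
by rewrite expr_le1// ?invr_ge0 ?invf_le1//; lra.
Qed.

Lemma forward_neq_backward y z : lifted_leaf pi F x y -> lifted_leaf pi F x z ->
  forward_endpoint ad y <> backward_end (orbit_line ad z).
Proof.
move=> /(orbit_chart_coord hc)[a [b [b0 _ yE]]] /(orbit_chart_coord hc)[a' [b' [b'0 _ zE]]].
move=> E; have [|||| K HK] := @asymptotic_bound (orbit_line ad y)
  (mk_unit_tangent (reverse_geodesic (orbit_line ad z)))
  (fun t => (a, b * expR (- t))) (fun t => (a', b' * expR t)) _ _ _ _ E.
- by move=> t; exact: down_gt0.
- by move=> t; exact: down_gt0.
- exact: yE.
- by move=> t; rewrite -[LHS]/(unit_flow ad (- t) z) zE opprK.
have : b' / b <= 0.
  apply: (@le0_exp _ _ K) => t t0; apply: le_trans (HK t t0).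
  have et : 1 <= expR t by rewrite -expR0 ler_expR.
  rewrite /hyp_form /= expRN; move: (expR t) et => e e1.
  have -> : ((a - a') ^+ 2 + (b * e^-1) ^+ 2 + (b' * e) ^+ 2) / (b * e^-1 * (b' * e)) =
    ((a - a') ^+ 2 + (b * e^-1) ^+ 2) / (b * b') + b' / b * e ^+ 2 by field; lra.
  apply: ler_wpDl.
    by rewrite divr_ge0// ?addr_ge0 ?sqr_ge0// mulr_ge0// ltW.
  rewrite ler_pM2l ?divr_gt0//; nra.
by rewrite leNgt divr_gt0.
Qed.

(** Descending verticals over distinct feet diverge: their horizontal term is multiplied by
    [expR t ^+ 2]. Equal ends thus force equal feet, and points on one vertical are on one orbit. *)
Lemma forward_endpoint_inj y z : lifted_leaf pi F x y -> lifted_leaf pi F x z ->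
  forward_endpoint ad y = forward_endpoint ad z -> exists t, z = unit_flow ad t y.
Proof.
move=> /(orbit_chart_coord hc)[a [b [b0 _ yE]]].
move=> /(orbit_chart_coord hc)[a' [b' [b'0 zh zE]]].
move=> E; have [|||| K HK] := @asymptotic_bound (orbit_line ad y) (orbit_line ad z)
  (fun t => (a, b * expR (- t))) (fun t => (a', b' * expR (- t))) _ _ _ _ E.
- by move=> t; exact: down_gt0.
- by move=> t; exact: down_gt0.
- exact: yE.
- exact: zE.
have aa : (a - a') ^+ 2 / (b * b') <= 0.
  apply: (@le0_exp _ _ K) => t t0; apply: le_trans (HK t t0).
  have et : 1 <= expR t by rewrite -expR0 ler_expR.
  rewrite /hyp_form /= expRN; move: (expR t) et => e e1.
  have -> : ((a - a') ^+ 2 + (b * e^-1) ^+ 2 + (b' * e^-1) ^+ 2) /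
      (b * e^-1 * (b' * e^-1)) =
    (b ^+ 2 + b' ^+ 2) / (b * b') + (a - a') ^+ 2 / (b * b') * e ^+ 2 by field; lra.
  apply: ler_wpDl.
    by rewrite divr_ge0// ?addr_ge0 ?sqr_ge0// mulr_ge0// ltW.
  apply: ler_wpM2l; last by nra.
  by rewrite divr_ge0 ?sqr_ge0// mulr_ge0// ltW.
have aE : a' = a.
  move: aa; rewrite pmulr_lle0 ?invr_gt0 ?mulr_gt0// => aa.
  have /eqP : (a - a') ^+ 2 = 0 by apply/eqP; rewrite eq_le aa sqr_ge0.
  by rewrite sqrf_eq0 subr_eq0 => /eqP.
exists (- ln (b' / b)); rewrite zh yE opprK lnK ?posrE ?divr_gt0// aE.
by rewrite mulrC divfK// gt_eqF.
Qed.

Lemma forward_end_line (v : unit_tangent D) gamma a p q b r s k :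
  (forall t, 0 < (gamma t).2) -> (forall t, h (gamma t) = line v t) ->
  geodesic_coefs gamma a p q b r s -> 0 < a -> 0 < k ->
  forward_end v = forward_endpoint ad (h (p / a, k)).
Proof.
move=> g0 hg gc a0 k0.
apply: (@asymptotic_in_chart v (orbit_line ad (h (p / a, k))) gamma
  (fun t => (p / a, k * expR (- t))) ((k * a)^-1 + k * a + k * b)) => //.
- by move=> t; exact: down_gt0.
- by move=> t; rewrite -[LHS]/(unit_flow ad t _); exact: hc.2.
move=> t t0; rewrite (geodesic_coefs_vertical t g0 gc a0 k0) lerD2l.
have [_ b0 _ _] := gc_ge0 gc.
rewrite ler_piMr//; first by rewrite mulr_ge0// ltW.
by rewrite expr_le1 ?expR_ge0// -expR0 ler_expR oppr_le0.
Qed.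

Lemma forward_end_up (v : unit_tangent D) gamma a p q b r s :
  (forall t, 0 < (gamma t).2) -> (forall t, h (gamma t) = line v t) ->
  geodesic_coefs gamma a p q b r s -> a = 0 ->
  forward_end v = backward_end (orbit_line ad (line v 0)).
Proof.
move=> g0 hg gc a0; apply: forward_end_eq_line => t.
rewrite -[RHS]/(unit_flow ad (- t) _) -!hg.
rewrite [in RHS](surjective_pairing (gamma 0)) hc.2// opprK.
by rewrite (geodesic_coefs_up t g0 gc a0).
Qed.

(** In the chart the form is [m + n * expR (- t) ^+ 2] with [m >= 2] and [n >= 0]. The resulting
    bound holds for negative times too and vanishes with [D y z], without synchronizing the two
    parametrizations. *)
Lemma exists_asymptotic y z : lifted_leaf pi F x y -> lifted_leaf pi F x z ->
  exists w : unit_tangent D, [/\ line w 0 = y, forward_end w = forward_endpoint ad z &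
    forall t, dcosh (D (line w t) (unit_flow ad t z)) - 2 <=
      (dcosh (D y z) - 2) * (1 + expR (- t) ^+ 2)].
Proof.
move=> /(orbit_chart_coord hc)[a [b [b0 yh yE]]].
move=> /(orbit_chart_coord hc)[c [d [d0 zh zE]]].
have [gamma [g0 g0E gB [A [p [q [B [r [s [gc A0 pA]]]]]]]]] :=
  geodesic_towards c (b0 : 0 < (a, b).2).
have gg := line_isometry hi g0 gB.
exists (mk_unit_tangent gg); split.
- by rewrite /line /= g0E.
- rewrite zh -pA; exact: (@forward_end_line (mk_unit_tangent gg) _ _ _ _ _ _ _ _ g0 _ gc).
move=> t; rewrite /line /= zE.
have dt := down_gt0 (- t) d0.
rewrite (isometry_dcosh hi)//.
have -> : D y z = D (h (gamma 0)) (h (c, d * expR (- 0))).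
  by rewrite g0E oppr0 expR0 mulr1 -yh -zh.
rewrite (isometry_dcosh hi)//=; last by exact: down_gt0.
rewrite -pA !(geodesic_coefs_vertical _ g0 gc A0 d0) oppr0 expR0 expr1n mulr1.
have [_ B0 _ _] := gc_ge0 gc.
have dA : 0 < d * A by exact: mulr_gt0.
have dB : 0 <= d * B by rewrite mulr_ge0// ltW.
have e0 := sqr_ge0 (expR (- t)).
have : 2 <= (d * A)^-1 + d * A.
  have -> : (d * A)^-1 + d * A = 2 + (d * A - 1) ^+ 2 / (d * A) by field; lra.
  by rewrite lerDl divr_ge0 ?sqr_ge0// ltW.
move: e0 dB; move: (expR _ ^+ 2) (_^-1 + _) (d * B) => e m n e0 n0 m2.
by nra.
Qed.
End OneLeaf.
End Ends.

(** * Openness *)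

Lemma dcosh_continuous (R : realType) : continuous (@dcosh R).
Proof.
move=> t; apply: cvgD; first exact: continuous_expR.
apply: (@continuous_comp _ _ _ (fun u : R => - u) expR); last exact: continuous_expR.
by apply: cvgN; exact: cvg_id.
Qed.

Section Endpoints.
Local Open Scope quotient_scope.
Context {R : realType} {X M : topologicalType} (pi : X -> M) (F : @foliation R M).
Context (lphi : flow R X) (D : leaf_metric pi F) (ad : adapted lphi D).
Hypothesis cov : covering pi.
Hypothesis cM : compact [set: M].
Hypothesis hM : hausdorff_space M.

Lemma forward_endpoint_leaf (v : unit_tangent D) x :
  forward_end v = forward_endpoint ad x -> lifted_leaf pi F x (line v 0).
Proof.
move=> /forward_endP[+ _] => vx; apply: lifted_leaf_sym.
by move: vx; rewrite -[line (orbit_line ad x) 0]/(unit_flow ad 0 x) unit_flow0.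
Qed.

Lemma forward_neq_nonmarker x z :
  forward_endpoint ad x <> backward_end (orbit_line ad z).
Proof.
move=> E; have [h hc] := exists_orbit_chart ad x.
have xz : lifted_leaf pi F x z.
  have := forward_endpoint_leaf (esym E).
  rewrite (_ : line _ 0 = unit_flow ad (- 0) z)//.
  by rewrite oppr0 unit_flow0.
exact: (forward_neq_backward hc (lifted_leaf_refl pi F x) xz E).
Qed.

Lemma forward_endpoint_orbit x y : forward_endpoint ad x = forward_endpoint ad y ->
  exists u, y = lphi u x.
Proof.
move=> E; have [h hc] := exists_orbit_chart ad x.
have xy : lifted_leaf pi F x y.
  apply: lifted_leaf_sym; have := forward_endpoint_leaf E.
  by rewrite -[line (orbit_line ad x) 0]/(unit_flow ad 0 x) unit_flow0.
have [t ->] := forward_endpoint_inj hc (lifted_leaf_refl pi F x) xy E.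
by exists (unit_time ad x t); rewrite unit_flowE.
Qed.

Lemma Einf_end (xi : Einf D) : exists v : unit_tangent D, xi = forward_end v.
Proof. by exists (repr xi); rewrite /forward_end reprK. Qed.

Lemma backward_end_eq x y : lifted_leaf pi F x y ->
  backward_end (orbit_line ad x) = backward_end (orbit_line ad y).
Proof.
move=> xy; have [h hc] := exists_orbit_chart ad x.
exact: (backward_end_chart hc (lifted_leaf_refl pi F x) xy).
Qed.

Lemma forward_endpoint_surj xi : (~` range (nonmarker ad)) xi ->
  exists x, forward_endpoint ad x = xi.
Proof.
have [v ->] := Einf_end xi => nm.
have [h hc] := exists_orbit_chart ad (line v 0).
have [gamma [g0 hg [a [p [q [b [r [s gc]]]]]]]] :=
  isometry_line hc.1 (lifted_leaf_refl pi F _) (line_geodesic v).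
have [a0|a0] := eqVneq a 0.
  case: nm; exists (\pi_(leaf_space pi F) (line v 0)) => //.
  rewrite (forward_end_up hc g0 hg gc a0); apply/esym/backward_end_eq.
  have : \pi_(leaf_space pi F) (repr (\pi_(leaf_space pi F) (line v 0))) =
     \pi_(leaf_space pi F) (line v 0) by rewrite reprK.
  by move=> /(@eqmodP _ (lifted_leaf_equiv pi F))/asboolP/lifted_leaf_sym.
have apos : 0 < a by rewrite lt_def a0; have [] := gc_ge0 gc.
by exists (h (p / a, 1)); rewrite (forward_end_line hc g0 hg gc apos ltr01).
Qed.

Lemma line_continuous t : continuous (fun v : unit_tangent D => line v t).
Proof.
move=> v A; rewrite nbhsE => -[W [oW Wv] WA].
pose B : set {compact-open, R -> X} := [set g | g @` [set t] `<=` W].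
have oB : open B by apply: compact_open_open => //; exact: compact_set1.
have nB : nbhs v (@line _ _ _ _ _ D @^-1` B).
  apply: open_nbhs_nbhs; split; first by exists B.
  by move=> _ [_ -> <-].
by apply: filterS nB => w Bw; apply: WA; apply: Bw; exists t.
Qed.

Lemma expR_small (c : R) : 0 < c -> exists2 T, 0 <= T & expR (- T) < c.
Proof.
move=> c0; exists (`|ln c| + 1); first by rewrite addr_ge0.
rewrite -[ltRHS](lnK (_ : c \is Num.pos)) ?posrE// ltr_expR.
by have := ler_norm (- ln c); rewrite normrN; lra.
Qed.

Lemma forward_end_near (V : set X) (v : unit_tangent D) x : open V ->
  (forall y u, V y -> V (lphi u y)) -> V x ->
  forward_end v = forward_endpoint ad x ->
  \forall w \near v, exists2 y, V y & forward_end w = forward_endpoint ad y.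
Proof.
move=> oV satV Vx vx; have [h hc] := exists_orbit_chart ad x.
have xv := forward_endpoint_leaf vx.
have [gamma [g0 hg [a [p [q [b [r [s gc]]]]]]]] :=
  isometry_line hc.1 xv (line_geodesic v).
have [a0|a0] := eqVneq a 0.
  have := forward_end_up hc g0 hg gc a0; rewrite vx => /forward_neq_nonmarker [].
have apos : 0 < a by rewrite lt_def a0; have [] := gc_ge0 gc.
have b0 : 0 <= b by have [] := gc_ge0 gc.
have ainv : 0 < a^-1 by rewrite invr_gt0.
(* At height [a^-1] the vertical orbit is synchronized with [gamma]: the points [line v T], flowed
   back by [T], converge to this one. *)
have Vx1 : V (h (p / a, a^-1)).
  have := forward_end_line hc g0 hg gc apos ainv.
  by rewrite vx => /forward_endpoint_orbit[u ->]; exact: satV.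
have [eta eta0 nP] := leaf_ball_near (adapted_continuous ad) (adapted_hyperbolic ad)
  cov cM hM (open_nbhs_nbhs (conj oV Vx1)).
(* [eta] does not depend on [T]: points of [w] at time [T] are flowed back by
   [-T] before being compared with [(p / a, 1 / a)]. *)
set P := (fun y => forall z, _) in nP.
have {}nP : nbhs (h (p / a, a^-1)) (P : set X)^° by exact: nbhs_interior.
have /nbhs_ballP[d /= d0 dP] : nbhs (p / a, a^-1) (h @^-1` (P : set X)^°).
  exact: (isometry_continuous hc.1 (z := (p / a, a^-1)) ainv).
pose m := dcosh eta - 2; have m0 : 0 < m by rewrite subr_gt0 dcosh_gt2.
(* For [k < 1], the condition [k < k0] is equivalent to [k / (1 - k) < m], as needed in
   [same_height_estimate]. *)
pose k0 := m / (1 + m).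
have k0pos : 0 < k0 by rewrite divr_gt0//; lra.
have k0lt : k0 < 1 by rewrite ltr_pdivrMr; lra.
have b1 : 0 < b + 1 by lra.
have [T T0] : exists2 T, 0 <= T & expR (- T) <
    Num.min (d * a) (Num.min (d * a ^+ 2 / (b + 1)) (k0 * a / (b + 1))).
  apply: expR_small; rewrite !lt_min; apply/and3P; split; first exact: mulr_gt0.
    by rewrite divr_gt0// mulr_gt0// exprn_gt0.
  by rewrite divr_gt0// mulr_gt0.
rewrite !lt_min => /and3P[T1 T2 T3].
have uf : expR T * expR (- T) = 1 :> R by rewrite -expRD subrr expR0.
have f0 : 0 < expR (- T) := expR_gt0 _.
have u1 : 1 <= expR T by rewrite -expR0 ler_expR.
have f1 : expR (- T) <= 1 :> R by rewrite -expR0 ler_expR; lra.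
have y0 := g0 T; have y1 := geodesic_coefs_height T g0 gc apos.
have circ := geodesic_coefs_circle T g0 gc apos.
have yinv := gc_inv gc T.
have [_ turn] := geodesic_turn T g0 gc.
have flow_down (w : unit_tangent D) z (h' : R * R -> X) (t c : R) :
    orbit_chart ad z h' -> forall g : R * R, 0 < g.2 -> line w t = h' g ->
    unit_flow ad c (line w t) = h' (g.1, g.2 * expR (- c)).
  by move=> hc' [g1 g2] /= g20 ->; exact: hc'.2.
have zT : (P : set X)^° (unit_flow ad (- T) (line v T)).
  rewrite (flow_down _ _ _ _ _ hc _ y0 (esym (hg T))) opprK; apply: dP.
  split; first exact: (horizontal_estimate apos f0 y0 circ T1).
  exact: (vertical_estimate apos b0 f0 f1 uf y0 yinv T2).
have kT : b * expR (- T) * (gamma T).2 < k0.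
  exact: (angle_estimate apos b0 f0 f1 y1 T3).
have near1 : \forall w \near v, P (unit_flow ad (- T) (line w T)).
  have c1 : {for v, continuous (unit_flow ad (- T) \o (fun w : unit_tangent D => line w T))}.
    by apply: continuous_comp; [exact: line_continuous | exact: unit_flow_continuous_point].
  exact: (c1 _ zT).
(* By [geodesic_turn], [E] is an increasing affine function of the angle parameter; being defined by
   a distance, it is continuous in [w] without any choice of charts. *)
pose E (w : unit_tangent D) := dcosh (D (line w (T + 1)) (unit_flow ad 1 (line w T))).
pose th := 2 + (expR 1 - expR (-1)) ^+ 2 * k0.
have ef : 0 < (expR 1 - expR (-1)) ^+ 2 :> R.
  by rewrite exprn_gt0// subr_gt0 ltr_expR; lra.
have cE : {for v, continuous E}.
  apply: (@continuous_comp _ _ _ _ (@dcosh R)); last exact: dcosh_continuous.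
  apply: (leaf_metric_continuous_for ad); first exact: line_continuous.
    by apply: continuous_comp; [exact: line_continuous | exact: unit_flow_continuous_point].
  have lf (w : unit_tangent D) : lifted_leaf pi F (line w (T + 1)) (unit_flow ad 1 (line w T)).
    by apply: lifted_leaf_trans (unit_flow_leaf _ _ _); exact: line_leaf.
  exact: (@filterE _ (nbhs v) _ _ lf).
have EE (w : unit_tangent D) z h' g : orbit_chart ad z h' -> (forall t, 0 < (g t).2) ->
    (forall t, h' (g t) = line w t) ->
    E w = hyp_form (g (T + 1)) ((g T).1, (g T).2 * expR (-1)).
  move=> hc' g0' hg'; rewrite /E (flow_down _ _ _ _ _ hc' _ (g0' T) (esym (hg' T))).
  by rewrite -hg' (isometry_dcosh hc'.1)//=; exact: down_gt0.
have near2 : \forall w \near v, E w < th.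
  apply: (cvgr_lt _ cE); rewrite (EE _ _ _ _ hc g0 hg) turn /th ltrD2l.
  by rewrite ltr_pM2l.
apply: filterS2 near1 near2 => w Pw.
have [h' hc'] := exists_orbit_chart ad (line w 0).
have [gamma' [g0' hg' [a' [p' [q' [b' [r' [s' gc']]]]]]]] :=
  isometry_line hc'.1 (lifted_leaf_refl pi F _) (line_geodesic w).
have [ak turn'] := geodesic_turn T g0' gc'.
rewrite (EE _ _ _ _ hc' g0' hg') turn' /th ltrD2l ltr_pM2l// => k'lt.
have circ' := geodesic_coefs_circle T g0' gc'.
have y0' := g0' T.
set k' := b' * _ * _ in ak k'lt.
(* [1 - k'] is positive, so [w] does not point vertically upward and its forward end is real. *)
have a'0 : 0 < a'.
  have : 0 < a' * (expR T * (gamma' T).2) by rewrite mulrA ak; lra.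
  by rewrite pmulr_lgt0// mulr_gt0// expR_gt0.
have k'0 : 0 <= k'.
  have [_ b'0 _ _] := gc_ge0 gc'.
  by rewrite /k' !mulr_ge0// ?expR_ge0// ltW.
(* The height of [line w T] flowed back by [T], so that the two points compared differ only
   horizontally. *)
pose Y := (gamma' T).2 * expR T.
have Y0 : 0 < Y by exact: down_gt0.
exists (h' (p' / a', Y)); last exact: (forward_end_line hc' g0' hg' gc' a'0 Y0).
apply: Pw; rewrite (flow_down _ _ _ _ _ hc' _ y0' (esym (hg' T))) opprK -/Y.
  exact: (isometry_leaf hc'.1).
rewrite (isometry_lt hc'.1)//; last exact: ltW.
have -> : dcosh eta = 2 + m by rewrite /m; lra.
exact: (same_height_estimate a'0 y0' u1 uf ak (circ' a'0) k'0 m0 k'lt).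
Qed.

End Endpoints.

(** * Continuity *)

Section Transversals.
Context {R : realType} {X M : topologicalType} (pi : X -> M) (F : @foliation R M).
Context (x : X) (c : @chart R M (2 + 1)) (V : set X) (r : R) (k : 'rV[R]_(2 + 1) -> X).
Hypothesis bx : box pi F x c V r k.
Let v0 := c (pi x).

Definition box_vertical (s : R) : 'rV[R]_(2 + 1) :=
  v0 + s *: delta_mx 0 ord_max.

Lemma trans_box_vertical s : trans_coord (box_vertical s) = trans_coord v0 + s.
Proof. by rewrite /trans_coord /box_vertical !mxE !eqxx mulr1. Qed.

Lemma box_vertical_ball s : `|s| < r -> ball v0 r (box_vertical s).
Proof.
move=> sr; have r0 := box_gt0 bx; split=> // i j.
rewrite /ball /= /box_vertical !mxE opprD addNKr normrN.
by case: (_ && _); rewrite ?mulr1// mulr0 normr0.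
Qed.

Lemma box_vertical_continuous : continuous box_vertical.
Proof.
by move=> s; apply: cvgD; [exact: cvg_cst | apply: cvgZr_tmp; exact: cvg_id].
Qed.

(** Centred at [x], its value at 1 / 2, with vertical parameter at most [r / 2] in absolute value;
    [clamp] keeps it in the box outside the unit interval as well. *)
Definition box_transversal (s : R) : X := k (box_vertical ((clamp s - 1 / 2) * r)).

Lemma box_transversal_ball s : ball v0 r (box_vertical ((clamp s - 1 / 2) * r)).
Proof.
have r0 := box_gt0 bx; apply: box_vertical_ball.
rewrite normrM (gtr0_norm r0) -[ltRHS]mul1r ltr_pM2r// ltr_norml.
by have := clamp_itv s; lra.
Qed.

Lemma box_transversalP : leaf_transversal pi F box_transversal.
Proof.
have r0 := box_gt0 bx.
have cinj s t : 0 <= s <= 1 -> 0 <= t <= 1 ->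
    trans_coord (box_vertical ((clamp s - 1 / 2) * r)) =
    trans_coord (box_vertical ((clamp t - 1 / 2) * r)) -> s = t.
  move=> s01 t01; rewrite !trans_box_vertical !clamp_id// => /addrI.
  by move/(mulIf (lt0r_neq0 r0)); lra.
split.
- move=> s; apply: continuous_comp; last exact: (box_cont bx (box_transversal_ball s)).
  apply: continuous_comp; last exact: box_vertical_continuous.
  apply: cvgM; last exact: cvg_cst.
  by apply: cvgB; [exact: clamp_continuous | exact: cvg_cst].
- move=> s t; rewrite !inE /= !in_itv /= => s01 t01 E; apply: cinj => //.
  by rewrite (box_inj bx (box_transversal_ball s) (box_transversal_ball t) E).
- move=> t t01; exists c; split; first exact: (box_atlas bx).
    exact: (box_dom_pi bx (box_transversal_ball t)).
  exists 1 => //; split.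
    move=> s s'; rewrite !inE /= => -[s01 _] [s01' _].
    rewrite !(boxE bx (box_transversal_ball _)); exact: cinj.
  by move=> s _ _; exact: (box_dom_pi bx (box_transversal_ball s)).
Qed.

Hypothesis cov : covering pi.

(** Sliding along plaques onto the transversal gives a base point in the leaf of [y] at which
    openness in [Einf] can be tested. *)
Lemma box_project : exists p : X -> X, [/\ p x = x, {for x, continuous p} &
  \forall y \near x, (box_transversal @` `[0, 1]) (p y) /\ lifted_leaf pi F (p y) y].
Proof.
have r0 := box_gt0 bx; have B0 : ball v0 r v0 by exact: ballxx.
pose tc y := trans_coord (c (pi y)) - trans_coord v0.
have kx : k v0 = x := box_center bx.
have ccx : {for x, continuous (c \o pi)}.
  by have := box_coord_continuous cov bx B0; rewrite -/v0 kx.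
have ctc : {for x, continuous tc}.
  apply: cvgB; last exact: cvg_cst.
  apply: (@continuous_comp _ _ _ (c \o pi) (fun v => trans_coord v)) => //.
  exact: coord_continuous.
have tcx : tc x = 0 by rewrite /tc subrr.
exists (fun y => k (box_vertical (tc y))); split.
- by rewrite tcx /box_vertical scale0r addr0.
- apply: (@continuous_comp _ _ _ (fun y => box_vertical (tc y)) k).
    by apply: continuous_comp; [exact: ctc | exact: box_vertical_continuous].
  by apply: (box_cont bx); rewrite tcx; apply: box_vertical_ball; rewrite normr0.
have n1 : \forall y \near x, `|tc y| < r / 2.
  have := ctc; move/cvgrPdist_lt => /(_ (r / 2)); rewrite divr_gt0// => /(_ isT).
  by apply: filterS => y; rewrite tcx sub0r normrN.
have n2 : \forall y \near x, cdom c (pi y) /\ k (c (pi y)) = y.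
  by have := box_near bx B0; rewrite -/v0 kx.
have n3 : \forall y \near x, ball v0 r (c (pi y)).
  by apply: ccx; exact: nbhsx_ballx.
apply: filterS3 n1 n2 n3 => y ty [cy ky] By.
have ty' : `|tc y| < r by lra.
split.
  move: ty; rewrite ltr_norml => /andP[t1 t2].
  pose s := 1 / 2 + tc y / r.
  have rr : tc y = tc y / r * r by rewrite divfK// gt_eqF.
  have s01 : 0 <= s <= 1.
    rewrite /s; have : - (1 / 2) < tc y / r by rewrite ltr_pdivlMr//; lra.
    have : tc y / r < 1 / 2 by rewrite ltr_pdivrMr//; lra.
    by lra.
  exists s; first by rewrite /= in_itv.
  rewrite /box_transversal clamp_id// (_ : (s - 1 / 2) * r = tc y)//.
  by rewrite [RHS]rr /s; congr (_ * r); ring.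
rewrite -[y in X in lifted_leaf _ _ _ X]ky; apply: (box_leaf bx) => //.
  exact: box_vertical_ball.
by rewrite trans_box_vertical /tc addrC subrK.
Qed.
End Transversals.

Section Continuity.
Context {R : realType} {X M : topologicalType} (pi : X -> M) (F : @foliation R M).
Context (lphi : flow R X) (D : leaf_metric pi F) (ad : adapted lphi D).
Hypothesis cov : covering pi.
Hypothesis cM : compact [set: M].
Hypothesis hM : hausdorff_space M.

(** The factor depending on [t] is bounded on compact sets while [D (q x) x] tends to 0, and
    [leaf_ball_near] turns leafwise closeness into closeness in [X]. The near-covering form of
    compactness reduces the claim to a neighbourhood of each [(t, p)]. *)
Lemma line_cvg p (W : X -> unit_tangent D) (q : X -> X) :
  q p = p -> {for p, continuous q} ->
  (\forall x \near p, lifted_leaf pi F (q x) x /\ forall t,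
    lifted_leaf pi F (unit_flow ad t x) (line (W x) t) /\
    dcosh (D (line (W x) t) (unit_flow ad t x)) - 2 <=
      (dcosh (D (q x) x) - 2) * (1 + expR (- t) ^+ 2)) ->
  forall B : set {compact-open, R -> X}, open B -> B (unit_flow ad ^~ p) ->
  \forall x \near p, B (line (W x)).
Proof.
move=> qp cq nq B oB Bp.
suff cv : (fun x => line (W x) : {compact-open, R -> X}) @ p -->
    (unit_flow ad ^~ p : {compact-open, R -> X}).
  by apply: cv; exact: open_nbhs_nbhs.
apply/compact_open_cvgP => K V cK oV KV.
pose P (x : X) (t : R) := V (line (W x) t).
have nP : \forall x \near p, K `<=` P x.
  move/compact_near_coveringP : cK; apply => t Kt.
  have Vt : nbhs (unit_flow ad t p) V.
    by apply: open_nbhs_nbhs; split=> //; apply: KV; exists t.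
  have [eta eta0 nV] := leaf_ball_near (adapted_continuous ad)
    (adapted_hyperbolic ad) cov cM hM Vt.
  have n1 : nbhs (t, p) [set z : R * X | forall y,
      lifted_leaf pi F (unit_flow ad z.1 z.2) y ->
      D (unit_flow ad z.1 z.2) y < eta -> V y].
    exact: (@unit_flow_continuous _ _ _ _ _ _ _ ad (t, p) _ nV).
  pose E (z : R * X) := (dcosh (D (q z.2) z.2) - 2) * (1 + expR (- z.1) ^+ 2).
  have cDq : {for p, continuous (fun x => dcosh (D (q x) x) - 2)}.
    apply: cvgB; last exact: cvg_cst.
    apply: (@continuous_comp _ _ _ (fun x => D (q x) x) (@dcosh R)).
      apply: (leaf_metric_continuous_for ad (f := q) (g := id)); first exact: cq.
        exact: cvg_id.
      by apply: filterS nq => x [].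
    exact: dcosh_continuous.
  have ce : continuous (fun s : R => 1 + expR (- s) ^+ 2).
    move=> s; apply: cvgD; first exact: cvg_cst.
    have cne : {for s, continuous (fun u : R => expR (- u))}.
      apply: (@continuous_comp _ _ _ (fun u : R => - u) expR); last exact: continuous_expR.
      by apply: cvgN; exact: cvg_id.
    exact: (cvgM cne cne).
  have cE : {for (t, p), continuous E}.
    apply: cvgM.
      have := @continuous_comp _ _ _ (@snd R X) (fun x => dcosh (D (q x) x) - 2) (t, p).
      by apply; [exact: cvg_snd | exact: cDq].
    have := @continuous_comp _ _ _ (@fst R X) (fun s : R => 1 + expR (- s) ^+ 2) (t, p).
    by apply; [exact: cvg_fst | exact: ce].
  have n2 : nbhs (t, p) [set z | E z < dcosh eta - 2].
    apply: (cvgr_lt _ cE); rewrite /E /= qp (ldist_eq0 D (lifted_leaf_refl pi F p)).2//.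
    by rewrite dcosh0 subrr mul0r subr_gt0 dcosh_gt2.
  have n3 : nbhs (t, p) [set z : R * X | lifted_leaf pi F (q z.2) z.2 /\ forall s,
    lifted_leaf pi F (unit_flow ad s z.2) (line (W z.2) s) /\
    dcosh (D (line (W z.2) s) (unit_flow ad s z.2)) - 2 <=
      (dcosh (D (q z.2) z.2) - 2) * (1 + expR (- s) ^+ 2)].
    exact: (@cvg_snd _ _ (nbhs t) (nbhs p) _ _ nq).
  suff : nbhs (t, p) [set z | V (line (W z.2) z.1)] by [].
  apply: filterS3 n1 n2 n3 => -[s x] /= Vs Es [_ /(_ s)[lf le]].
  apply: Vs => //; rewrite -ltr_dcosh; last 2 first.
  - exact: ldist_ge0.
  - exact: ltW.
  rewrite ldist_sym// -(ltrD2r (- 2)); exact: le_lt_trans le Es.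
by apply: filterS nP => x KP _ [t Kt <-]; exact: KP.
Qed.

Lemma forward_endpoint_near (U : set (Einf D)) p : open U ->
  U (forward_endpoint ad p) -> \forall x \near p, U (forward_endpoint ad x).
Proof.
move=> oU Up; have [c [r [k bx]]] := exists_box F cov (filterT : nbhs p [set: X]).
pose tau := box_transversal pi p c r k.
have [q [qp cq nq]] := box_project bx cov.
(* Unwinding the two subtypes, vectors based on [tau] among all unit vectors among all functions,
   yields an open set [B] of functions. *)
have [A oA AE] : open (@end_along _ _ _ _ _ D tau @^-1` U) := oU _ (box_transversalP bx).
have [B oB BE] := oA.
have H x : exists w : unit_tangent D, lifted_leaf pi F (q x) x ->
  [/\ line w 0 = q x, forward_end w = forward_endpoint ad x &
    forall t, dcosh (D (line w t) (unit_flow ad t x)) - 2 <=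
      (dcosh (D (q x) x) - 2) * (1 + expR (- t) ^+ 2)].
  (* Where [q x] is not in the leaf of [x], the orbit line is a default value that makes [W]
     total. *)
  have [qx|nqx] := pselect (lifted_leaf pi F (q x) x); last by exists (orbit_line ad x).
  have [h hc] := exists_orbit_chart ad x.
  have [w Hw] := exists_asymptotic hc (lifted_leaf_sym qx) (lifted_leaf_refl pi F x).
  by exists w.
have [W HW] := choice H.
have BW x : (tau @` `[0, 1]) (q x) -> lifted_leaf pi F (q x) x ->
    B (line (W x)) <-> U (forward_endpoint ad x).
  move=> tx /HW[W0 WE _].
  have al : unit_tangent_along tau (W x) by rewrite /unit_tangent_along /= W0.
  pose s : set_type (@unit_tangent_along _ _ _ _ _ D tau) := exist _ (W x) (mem_set al).
  have -> : U (forward_endpoint ad x) = (@end_along _ _ _ _ _ D tau @^-1` U) s.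
    by rewrite /= /end_along /= WE.
  by rewrite -AE /= -BE.
have [tp lp] := nbhs_singleton nq.
have Bp : B (unit_flow ad ^~ p).
  have [_ _ Wd] := HW _ lp.
  (* As [q p = p], the bound at [p] is zero and the two lines agree at all times. *)
  have -> : unit_flow ad ^~ p = line (W p).
    apply/funext => t.
    have lf : lifted_leaf pi F (line (W p) t) (unit_flow ad t p).
      apply: lifted_leaf_trans (unit_flow_leaf ad t p).
      by apply: lifted_leaf_trans (line_leaf (W p) t 0) _; have [-> _ _] := HW _ lp.
    apply/esym/(ldist_eq0 D lf); apply: dcosh_inj => //; first exact: ldist_ge0.
    have := Wd t; rewrite {1}qp (ldist_eq0 D (lifted_leaf_refl pi F p)).2//.
    rewrite dcosh0 subrr mul0r subr_le0 => le2; apply/eqP; rewrite eq_le le2 /=.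
    by rewrite -dcosh0 ler_dcosh ?ldist_ge0.
  by apply/BW.
have nW : \forall x \near p, lifted_leaf pi F (q x) x /\ forall t,
    lifted_leaf pi F (unit_flow ad t x) (line (W x) t) /\
    dcosh (D (line (W x) t) (unit_flow ad t x)) - 2 <=
      (dcosh (D (q x) x) - 2) * (1 + expR (- t) ^+ 2).
  apply: filterS nq => x [_ qx]; split=> // t; have [W0 _ Wd] := HW _ qx.
  split=> //; apply: lifted_leaf_trans (line_leaf (W x) 0 t); rewrite W0.
  by apply: lifted_leaf_trans (lifted_leaf_sym qx); exact/lifted_leaf_sym/unit_flow_leaf.
have nB := line_cvg qp cq nW oB Bp.
by apply: filterS2 nq nB => x [tx qx] /BW; exact.
Qed.

Context (phi : flow R M).
Hypothesis lift : lifted_flow pi phi lphi.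

Lemma deck_flow (g : deck pi) t x : g (lphi t x) = lphi t (g x).
Proof.
apply: (covering_lift_unique cov (f := fun t => g (lphi t x))
  (g := fun t => lphi t (g x))).
- move=> u; apply: (@continuous_comp _ _ _ (lphi ^~ x) g); last exact: deck_cont.
  exact: flow_continuous_time.
- exact: flow_continuous_time.
- by move=> u; rewrite deck_pi !lift deck_pi.
- by rewrite !flow0.
Qed.

Lemma deck_forward_endpoint (g : deck pi) x :
  forward_endpoint ad (g x) = deck_Einf g (forward_endpoint ad x).
Proof.
rewrite /forward_endpoint deck_EinfE; apply: forward_end_eq_line.
apply: (orbit_geodesic_unique (orbit_lineP ad (g x))).
have [s rs sE] := orbit_lineP ad x; exists s => // t.
by rewrite -deck_flow -sE.
Qed.
End Continuity.

(** * The orbit space and the homeomorphism *)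

Section OrbitSpace.
Context {R : realType} {X : topologicalType} (lphi : flow R X).

Lemma orbit_ofP x y : orbit_of lphi x = orbit_of lphi y <-> flow_orbit lphi x y.
Proof.
split=> [/(@eqmodP _ (orbit_equiv lphi))/asboolP //|xy].
by apply/eqmodP/asboolP.
Qed.

Lemma orbit_of_repr (o : orbit_space lphi) : orbit_of lphi (repr o) = o.
Proof. exact: reprK. Qed.

Lemma orbit_space_open (V : set (orbit_space lphi)) :
  open V = open (orbit_of lphi @^-1` V).
Proof. by []. Qed.
End OrbitSpace.

Theorem theorem3 (R : realType) (M : metricType R) (X : topologicalType)
    (pi : X -> M) (phi : flow R M) (Ws Wu : @foliation R M)
    (lphi : flow R X) (D : leaf_metric pi Wu)
    (M_closed : @closed_manifold R 3 M)
    (M_orientable : @orientable_manifold R 3 M)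
    (M_irreducible : @irreducible_manifold R M)
    (pi_universal : universal_cover R pi)
    (M_atoroidal : atoroidal pi)
    (phi_anosov : anosov phi Ws Wu)
    (Ws_orientable : orientable_foliation Ws)
    (Wu_orientable : orientable_foliation Wu)
    (lphi_lift : lifted_flow pi phi lphi)
    (ad : adapted lphi D) :
  exists Phi : orbit_space lphi -> Einf D,
    [/\ forall p : X, Phi (orbit_of lphi p) = forward_endpoint ad p,
        forall (g : deck pi) (p : X),
          Phi (orbit_of lphi (g p)) = deck_Einf g (Phi (orbit_of lphi p)) &
        homeo_on [set: orbit_space lphi] (~` range (nonmarker ad)) Phi].
Proof.
have [cov _] := pi_universal; have [cM _ hM _] := M_closed.
pose Phi (o : orbit_space lphi) := forward_endpoint ad (repr o).
have PhiE p : Phi (orbit_of lphi p) = forward_endpoint ad p.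
  have /esym/orbit_ofP[u _ uE] := orbit_of_repr (orbit_of lphi p).
  by rewrite /Phi -uE forward_endpoint_flow.
have Phi_inj : injective Phi.
  move=> a b /forward_endpoint_orbit[u uE].
  by rewrite -(orbit_of_repr a) -(orbit_of_repr b); apply/orbit_ofP; exists u.
have nmPhi o : (~` range (nonmarker ad)) (Phi o).
  by move=> [l _ /esym]; exact: forward_neq_nonmarker.
exists Phi; split=> //.
  move=> g p; rewrite !PhiE; exact: deck_forward_endpoint lphi_lift _ _.
(* Over the nonmarker section the inverse takes an arbitrary value; [homeo_on] constrains it only on
   its target. *)
have inv xi : exists o, (~` range (nonmarker ad)) xi -> Phi o = xi.
  have [/(forward_endpoint_surj (ad := ad))[x xE]|nxi] :=
    pselect ((~` range (nonmarker ad)) xi).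
    by exists (orbit_of lphi x) => _; rewrite PhiE.
  by exists (orbit_of lphi (line (repr xi) 0)).
have [Psi PhiK] := choice inv.
exists Psi; split.
- by move=> o _; split; [exact: nmPhi | apply: Phi_inj; exact: PhiK].
- by move=> xi /PhiK.
- apply: continuous_subspaceT => o U; rewrite nbhsE => -[U' [oU' U'o] U'U].
  have : open (Phi @^-1` U').
    rewrite orbit_space_open openE => p; rewrite /= PhiE => Up.
    have := forward_endpoint_near cov cM hM oU' Up.
    by apply: filterS => y; rewrite /= PhiE.
  move=> oPhi; have : nbhs o (Phi @^-1` U') by exact: open_nbhs_nbhs.
  by apply: filterS => o' /U'U.
- apply: continuous_in_subspaceT => xi; rewrite inE => nmxi V.
  rewrite nbhsE => -[V' [oV' V'xi] V'V].
  pose W := [set eta : Einf D | exists2 o, V' o & eta = Phi o].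
  have oW : open W.
    (* One open set of unit vectors serves all transversals, since [forward_end_near] puts no
       condition on base points. *)
    move=> tau _; exists [set v : unit_tangent D | W (forward_end v)] => //.
    rewrite openE => v [a V'a va].
    have sat y u : (orbit_of lphi @^-1` V') y -> (orbit_of lphi @^-1` V') (lphi u y).
      rewrite /=; have -> // : orbit_of lphi (lphi u y) = orbit_of lphi y.
      by apply/esym/orbit_ofP; exists u.
    have oV'' : open (orbit_of lphi @^-1` V') by [].
    have V'r : (orbit_of lphi @^-1` V') (repr a) by rewrite /= orbit_of_repr.
    have := forward_end_near cov cM hM oV'' sat V'r va.
    apply: filterS => w [y V'y wy]; exists (orbit_of lphi y) => //.
    by rewrite PhiE.
  have Wxi : nbhs xi W.
    by apply: open_nbhs_nbhs; split=> //; exists (Psi xi) => //; rewrite PhiK.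
  apply: filterS Wxi => eta [a V'a ->]; apply: V'V.
  suff -> : Psi (Phi a) = a by [].
  by apply: Phi_inj; exact: PhiK.
Qed.
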